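(* Let $n\ge 3$ and let $\mathcal{B}_R$ be a geodesic ball of radius $R\in(0,\pi/2)$ in the elliptic space $\mathbb{S}^n$, i.e. the Riemannian model with metric $ds^2=dr^2+\sin(r)^2\,d\Theta^2$ in polar coordinates around the center. Consider the problem $$-\Delta_g u=\lambda f(u)\ \text{in }\mathcal{B}_R,\qquad u>0\ \text{in }\mathcal{B}_R,\qquad u=0\ \text{on }\partial\mathcal{B}_R,$$ with extremal parameter $\lambda^*$ and extremal solution $u^*$. Let $$R_0:=\sup\Big\{s\in(0,\pi/2):\frac{\sin^2 s}{(1-\cos s)^2}>n(n-2)\Big\},$$ and $N(m):=2+\frac{4m}{m-1}+4\sqrt{\frac{m}{m-1}}$ for $m>1$. (i) Let $f(u)=\frac{e^u}{\sin(R)^2}-\frac{n-1}{n-2}$ and $R_{\rm e}:=\arcsin\left(\sqrt{\frac{n-2}{n-1}}\right)$. If $n\ge 10$ and $R<\min\{R_0,R_{\rm e}\}$, then $\lambda^*=2(n-2)$ and $u^*(r)=-2\log\left(\frac{\sin r}{\sin R}\right)$. (ii) Let $m>1$, $f(u)=\left(u+\sin(R)^{-\frac{2}{m-1}}\right)\left(\left(u+\sin(R)^{-\frac{2}{m-1}}\right)^{m-1}-\frac{(m-1)n-(m+1)}{(m-1)n-2m}\right)$ and $R_{\rm p}:=\arcsin\left(\sqrt{\frac{n-2}{n}}\right)$. If $n\ge N(m)$ and $R<\min\{R_0,R_{\rm p}\}$, then $\lambda^*=\frac{2}{m-1}\left(n-\frac{2m}{m-1}\right)$ and $u^*(r)=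\sin(r)^{-\frac{2}{m-1}}-\sin(R)^{-\frac{2}{m-1}}$.
   Context: $\Delta_g$ is the Laplace–Beltrami operator and $r$ the geodesic distance to the center of the ball. For $f$ a $C^1$ positive increasing function with $\lim_{t\to\infty}f(t)/t=+\infty$, there is $\lambda^*\in(0,\infty)$ such that for $\lambda\in(0,\lambda^* )$ the problem has a minimal classical solution $u_\lambda$ (smaller than any supersolution), which is semistable and increasing in $\lambda$, and for $\lambda>\lambda^*$ there is no classical solution; $\lambda^*$ is the extremal parameter and $u^*:=\lim_{\lambda\uparrow\lambda^*}u_\lambda$ is the extremal solution, a weak solution for $\lambda=\lambda^*$ (i.e. $u^*\in L^1$, $f(u^* )(R-r)\in L^1$, and $-\int u^*\Delta_g\xi\,dv_g=\lambda^*\int f(u^* )\xi\,dv_g$ for all $\xi\in C^1_0(\mathcal{B}_R)$). *)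

(* Defs.v *)
From HB Require Import structures.
From mathcomp Require Import all_boot all_order all_algebra.
From mathcomp Require Import all_classical all_reals all_analysis.
Set Implicit Arguments. Unset Strict Implicit. Unset Printing Implicit Defensive.
Import Order.TTheory GRing.Theory Num.Theory.
Import numFieldNormedType.Exports.
Local Open Scope classical_set_scope.
Local Open Scope ring_scope.

(* The sphere S^n is realized as the unit sphere of R^(n+1) = 'rV[R]_(n.+1),
   with the round metric induced by the Euclidean one (this is the elliptic
   space / Riemannian model ds^2 = dr^2 + sin(r)^2 dTheta^2 around any point). *)

Section Defs.
Variable R : realType.
Variable k : nat.  (* ambient dimension n+1 *)

Definition edot (x y : 'rV[R]_k) : R := \sum_(i < k) x ord0 i * y ord0 i.
Definition enorm (x : 'rV[R]_k) : R := Num.sqrt (edot x x).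
Definition on_sphere (p : 'rV[R]_k) : Prop := edot p p = 1.

Definition ebasis (i : 'I_k) : 'rV[R]_k := delta_mx ord0 i.

Definition partial (i : 'I_k) (f : 'rV[R]_k -> R) (x : 'rV[R]_k) : R :=
  'D_(ebasis i) f x.

Definition elap (f : 'rV[R]_k -> R) (x : 'rV[R]_k) : R :=
  \sum_(i < k) partial i (partial i f) x.

Definition C2_on (U : set 'rV[R]_k) (f : 'rV[R]_k -> R) : Prop :=
  forall x, U x ->
    [/\ {for x, continuous f},
        (forall i, derivable f x (ebasis i) /\ {for x, continuous (partial i f)}) &
        (forall i j, derivable (partial i f) x (ebasis j) /\
                     {for x, continuous (partial j (partial i f))})].

Definition hext (u : 'rV[R]_k -> R) (x : 'rV[R]_k) : R := u ((enorm x)^-1 *: x).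

(* Laplace--Beltrami operator of S^n: Delta_g u (p) = Delta (u(x/|x|)) at p *)
Definition LB (u : 'rV[R]_k -> R) (p : 'rV[R]_k) : R := elap (hext u) p.

Definition gdist (c p : 'rV[R]_k) : R := acos (edot p c).

Definition gball (c : 'rV[R]_k) (Rad : R) : set 'rV[R]_k :=
  [set p | on_sphere p /\ gdist c p < Rad].
Definition gcball (c : 'rV[R]_k) (Rad : R) : set 'rV[R]_k :=
  [set p | on_sphere p /\ gdist c p <= Rad].
Definition gsphere (c : 'rV[R]_k) (Rad : R) : set 'rV[R]_k :=
  [set p | on_sphere p /\ gdist c p = Rad].

Definition gcone (c : 'rV[R]_k) (Rad : R) : set 'rV[R]_k :=
  [set x | x != 0 /\ gball c Rad ((enorm x)^-1 *: x)].

(* regularity class of classical (super)solutions: C^2(B_R) /\ C(closure B_R) *)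
Definition classical_reg (c : 'rV[R]_k) (Rad : R) (u : 'rV[R]_k -> R) : Prop :=
  C2_on (gcone c Rad) (hext u) /\ {within gcball c Rad, continuous u}.

Definition classical_sol (c : 'rV[R]_k) (Rad : R) (f : R -> R) (lam : R)
  (u : 'rV[R]_k -> R) : Prop :=
  [/\ classical_reg c Rad u,
      (forall p, gball c Rad p -> - LB u p = lam * f (u p)),
      (forall p, gball c Rad p -> 0 < u p) &
      (forall p, gsphere c Rad p -> u p = 0)].

Definition classical_supersol (c : 'rV[R]_k) (Rad : R) (f : R -> R) (lam : R)
  (v : 'rV[R]_k -> R) : Prop :=
  [/\ classical_reg c Rad v,
      (forall p, gball c Rad p -> lam * f (v p) <= - LB v p) &
      (forall p, gcball c Rad p -> 0 <= v p)].

Definition minimal_sol (c : 'rV[R]_k) (Rad : R) (f : R -> R) (lam : R)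
  (u : 'rV[R]_k -> R) : Prop :=
  classical_sol c Rad f lam u /\
  forall v, classical_supersol c Rad f lam v -> forall p, gball c Rad p -> u p <= v p.

Definition lamstar (c : 'rV[R]_k) (Rad : R) (f : R -> R) : R :=
  sup [set lam | 0 < lam /\ exists u, classical_sol c Rad f lam u].

End Defs.

Definition R0 (R : realType) (n : nat) : R :=
  sup [set s : R | 0 < s < pi / 2 /\
        n%:R * (n%:R - 2) < sin s ^+ 2 / (1 - cos s) ^+ 2].

Definition Nm (R : realType) (m : R) : R :=
  2 + 4 * m / (m - 1) + 4 * Num.sqrt (m / (m - 1)).

Definition f_exp (R : realType) (n : nat) (Rad : R) (u : R) : R :=
  expR u / sin Rad ^+ 2 - (n%:R - 1) / (n%:R - 2).

Definition f_pow (R : realType) (n : nat) (m Rad : R) (u : R) : R :=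
  let a := sin Rad `^ (- (2 / (m - 1))) in
  (u + a) * ((u + a) `^ (m - 1)
             - ((m - 1) * n%:R - (m + 1)) / ((m - 1) * n%:R - 2 * m)).

(* Main.v *)
Require Import Defs.
From HB Require Import structures.
From mathcomp Require Import all_boot all_order all_algebra.
From mathcomp Require Import all_classical all_reals all_analysis.
From mathcomp Require Import ring lra.
Import Order.TTheory GRing.Theory Num.Theory.
Import numFieldNormedType.Exports.
Local Open Scope classical_set_scope.
Local Open Scope ring_scope.
Set Implicit Arguments.
Unset Strict Implicit.
Unset Printing Implicit Defensive.

(** In the variable x = cos r a radial function w(x) has Laplacian
    (1 - x^2) w'' - n x w', so that -Lap w = g is a first-order equation for w'.
    Let ws be the explicit singular solution, of parameter L.

    An improved Hardy weight ph, with -Lap ph >= L f'(ws) ph + f(ws), dominates ws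
    at the centre.  If v is a solution of parameter lam, then at an interior maximum
    of (ws - v) / ph the second-order condition and the convexity of f force the
    maximum to be at most L - lam.  Hence ws - v <= max(0, L - lam) ph: for lam > L
    this contradicts the boundedness of v, and as lam tends to L from below it
    bounds the minimal solutions from below.

    For lam < L, replacing sin^2 r by sin^2 r + d in ws gives, for small d, a smooth
    supersolution below ws.  A solution below it is a Knaster-Tarski fixed point of
    the monotone radial solution operator on a lattice of Lipschitz functions, and
    minimality bounds the minimal solutions by ws from above. *)

(** * Real calculus *)

Section RealCalculus.
Context {R : realType}.
Implicit Types (f g h : R -> R) (x y a b : R).

(** The weight [ph] is a positive strict supersolution of the equation linearized at [ws]; it
    encodes the stability of [ws] pointwise, so comparison reduces to second-order conditions at a
    maximum. The obstacle is the centre, where [ws] blows up: [ph] must blow up faster, to keep the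
    maximum of the quotient away from it. With Q = sin^2 r the weight is Q^(-g) (cos r - A), where g
    = (n - 2) / 4 is the exponent of the optimal Hardy constant. Each hypothesis has one task. The
    bounds n >= 10 and n >= N(m) give L f'(ws) <= (n - 2)^2 / (4 Q). The radius R0 makes cos r - A
    positive on the ball. The radii R_e and R_p give f(0) > 0, which leaves room for the regularized
    supersolutions. The extra term f(ws) in the inequality for [ph] makes the comparison
    quantitative, with error L - lam. The variable x = cos r is the linear function [edot p c] of
    the point, so a radial function that is smooth in x past x = 1 is smooth across the centre. *)

Lemma der_ext f g x a b : is_derive x 1 f a -> f =1 g -> a = b ->
  is_derive x 1 g b.
Proof. by move=> fa /funext <- <-. Qed.

Lemma der_near f g x a : is_derive x 1 f a -> (\near x, f x = g x) ->
  is_derive x 1 g a.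
Proof. by move=> fa fg; exact: near_eq_is_derive fa. Qed.

Lemma der_id x : is_derive x 1 (fun y : R => y) 1.
Proof. exact: is_derive_id. Qed.

Lemma der_cst k x : is_derive x 1 (fun=> k : R) 0.
Proof. exact: is_derive_cst. Qed.

Lemma derD f g x a b : is_derive x 1 f a -> is_derive x 1 g b ->
  is_derive x 1 (fun y => f y + g y) (a + b).
Proof. by move=> fa gb; exact: is_deriveD. Qed.

Lemma derN f x a : is_derive x 1 f a -> is_derive x 1 (fun y => - f y) (- a).
Proof. by move=> fa; exact: is_deriveN. Qed.

Lemma derB f g x a b : is_derive x 1 f a -> is_derive x 1 g b ->
  is_derive x 1 (fun y => f y - g y) (a - b).
Proof. by move=> fa gb; exact: is_deriveB. Qed.

Lemma derM f g x a b : is_derive x 1 f a -> is_derive x 1 g b ->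
  is_derive x 1 (fun y => f y * g y) (a * g x + f x * b).
Proof.
move=> fa gb; have := is_deriveM fa gb.
by rewrite /GRing.scale /= addrC (mulrC (g x)).
Qed.

Lemma derZ k f x a : is_derive x 1 f a -> is_derive x 1 (fun y => k * f y) (k * a).
Proof. by move=> fa; have := derM (der_cst k x) fa; rewrite mul0r add0r. Qed.

Lemma derX n f x a : is_derive x 1 f a ->
  is_derive x 1 (fun y => f y ^+ n) (n%:R * f x ^+ n.-1 * a).
Proof.
move=> fa; have := is_deriveX n fa; rewrite /GRing.scale /=.
by move/der_ext; apply => // y; rewrite fctE.
Qed.

Lemma derV f x a : f x != 0 -> is_derive x 1 f a ->
  is_derive x 1 (fun y => (f y)^-1) (- a / f x ^+ 2).
Proof.
move=> fx fa; have := is_deriveV fx fa; rewrite /GRing.scale /=.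
by move/der_ext; apply => //; rewrite mulrC mulrN mulNr.
Qed.

Lemma der_comp f g x a b : is_derive (g x) 1 f a -> is_derive x 1 g b ->
  is_derive x 1 (fun y => f (g y)) (a * b).
Proof. by move=> fa gb; exact: is_derive1_comp. Qed.

Lemma der_continuous f x a : is_derive x 1 f a -> {for x, continuous f}.
Proof. by move=> [d _]; apply: differentiable_continuous; apply/derivable1_diffP. Qed.

Lemma cont_comp f g x : {for x, continuous g} -> {for g x, continuous f} ->
  {for x, continuous (fun y => f (g y))}.
Proof. by move=> gc fc; exact: (continuous_comp gc fc). Qed.

Lemma contD (T : topologicalType) (f g : T -> R) (x : T) : {for x, continuous f} -> {for x, continuous g} ->
  {for x, continuous (fun t => f t + g t)}.
Proof. by move=> fc gc; exact: (@continuousD _ _ _ f g x fc gc). Qed.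

Lemma contN (T : topologicalType) (f : T -> R) (x : T) : {for x, continuous f} ->
  {for x, continuous (fun t => - f t)}.
Proof. by move=> fc; exact: (@continuousN _ _ _ f x fc). Qed.

Lemma contB (T : topologicalType) (f g : T -> R) (x : T) : {for x, continuous f} -> {for x, continuous g} ->
  {for x, continuous (fun t => f t - g t)}.
Proof. by move=> fc gc; exact: (@continuousB _ _ _ f g x fc gc). Qed.

Lemma contM (T : topologicalType) (f g : T -> R) (x : T) : {for x, continuous f} -> {for x, continuous g} ->
  {for x, continuous (fun t => f t * g t)}.
Proof. by move=> fc gc; exact: (@continuousM _ _ f g x fc gc). Qed.

Lemma contZ (T : topologicalType) k (f : T -> R) (x : T) : {for x, continuous f} ->
  {for x, continuous (fun t => k * f t)}.
Proof. by move=> fc; apply: contM fc; exact: cst_continuous. Qed.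

Lemma contV (T : topologicalType) (f : T -> R) (x : T) : f x != 0 -> {for x, continuous f} ->
  {for x, continuous (fun t => (f t)^-1)}.
Proof. by move=> f0 fc; exact: (cvgV f0 fc). Qed.

Lemma near_gt (T : topologicalType) (f : T -> R) (x : T) a :
  {for x, continuous f} -> a < f x -> \forall t \near x, a < f t.
Proof. by move=> fc; exact: (cvgr_gt (f x) fc). Qed.

Lemma near_lt (T : topologicalType) (f : T -> R) (x : T) a :
  {for x, continuous f} -> f x < a -> \forall t \near x, f t < a.
Proof. by move=> fc; exact: (cvgr_lt (f x) fc). Qed.

Lemma near_all (T : topologicalType) (x : T) (P : T -> Prop) :
  (forall t, P t) -> \forall t \near x, P t.
Proof. by move=> PT; apply: filterE. Qed.

Lemma near_continuous (T : topologicalType) (f g : T -> R) (x : T) :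
  (\forall t \near x, f t = g t) -> {for x, continuous g} -> {for x, continuous f}.
Proof.
move=> fg gc; rewrite /prop_for /continuous_at (nbhs_singleton fg).
by apply: cvg_trans gc; apply: near_eq_cvg; apply: filterS fg => t ->.
Qed.

Lemma near_itvoo x a b : a < x < b -> \forall t \near x, a < t < b.
Proof.
have idc : {for x, continuous (fun t : R => t)} by exact: (der_continuous (der_id x)).
by move=> /andP[ax xb]; near=> t; apply/andP; split; near: t; [exact: (near_gt idc)|exact: (near_lt idc)].
Unshelve. all: by end_near. Qed.

Lemma within_itv_continuous f a b :
  (forall x, a <= x <= b -> {for x, continuous f}) -> {within `[a, b], continuous f}.
Proof.
move=> fc; apply: continuous_in_subspaceT => x.
by rewrite inE /= in_itv; exact: fc.
Qed.

Lemma der_mono f (df : R -> R) a b : a <= b ->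
  (forall x, a < x < b -> is_derive x 1 f (df x)) ->
  (forall x, a < x < b -> 0 <= df x) ->
  (forall x, a <= x <= b -> {for x, continuous f}) -> f a <= f b.
Proof.
rewrite le_eqVlt => /predU1P[->//|ab] fd d0 /within_itv_continuous fc.
have {}fd x : x \in `]a, b[ -> is_derive x 1 f (df x) by rewrite in_itv; exact: fd.
have [c] := MVT ab fd fc.
by rewrite in_itv => /d0 ? E; rewrite -subr_ge0 E mulr_ge0// subr_ge0 ltW.
Qed.

Lemma der_const f a b : a <= b ->
  (forall x, a < x < b -> is_derive x 1 f 0) ->
  (forall x, a <= x <= b -> {for x, continuous f}) -> f a = f b.
Proof.
rewrite le_eqVlt => /predU1P[->//|ab] fd /within_itv_continuous fc.
have {}fd x : x \in `]a, b[ -> is_derive x 1 f 0 by rewrite in_itv; exact: fd.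
have [c] := @MVT _ f (fun=> 0) a b ab fd fc.
by rewrite mul0r => _ /eqP; rewrite subr_eq0 => /eqP.
Qed.

Lemma primitive_ex g a b : continuous g -> exists2 G : R -> R,
  G b = 0 & forall x, a < x -> is_derive x 1 G (g x).
Proof.
move=> gc.
pose F x : R := \int[lebesgue_measure]_(t in `[a, x]) g t.
exists (fun x => F x - F b); first by rewrite subrr.
move=> x ax.
have I : lebesgue_measure.-integrable `[a, x + 1] (EFin \o g).
  by apply: continuous_compact_integrable; [exact: segment_compact|exact: continuous_subspaceT].
have xx : x < x + 1 by rewrite ltrDl.
have [d e] := continuous_FTC1_closed xx I ax (gc x).
have Fx : is_derive x 1 F (g x) by split; [exact: d|rewrite -derive1E; exact: e].
by apply: der_ext (derB Fx (der_cst (F b) x)) _ _ => //; rewrite subr0.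
Qed.

(* n-th power of sin in terms of the variable x = cos r. *)
Definition sinpow (n : nat) (x : R) : R := Num.sqrt (1 - x ^+ 2) ^+ n.

(** [Num.sqrt] vanishes on negative numbers, so continuity holds on the whole line and sources
    multiplied by [sinpow n] can be integrated past x = 1. *)
Lemma sinpow_continuous n : continuous (sinpow n).
Proof.
move=> x; have Qc := der_continuous (derB (der_cst 1 x) (derX 2 (der_id x))).
have sc := cont_comp Qc (@sqrt_continuous R _).
exact: (cont_comp sc (der_continuous (derX n (der_id _)))).
Qed.

Lemma sinpow1 n : (0 < n)%N -> sinpow n 1 = 0.
Proof. by move=> n0; rewrite /sinpow expr1n subrr sqrtr0 expr0n gtn_eqF. Qed.

Lemma sinpow_gt0 n x : -1 < x < 1 -> 0 < sinpow n x.
Proof. by move=> x1; rewrite exprn_gt0// sqrtr_gt0; nra. Qed.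

Lemma sinpow2 n x : -1 < x < 1 -> sinpow n.+2 x = sinpow n x * (1 - x ^+ 2).
Proof.
move=> x1; have Q0 : 0 <= 1 - x ^+ 2 by nra.
by rewrite /sinpow -[X in _ = _ * X](sqr_sqrtr Q0) -exprD addn2.
Qed.

Lemma der_sinpow n x : -1 < x < 1 ->
  is_derive x 1 (sinpow n) (- (n%:R * x * sinpow n x) / (1 - x ^+ 2)).
Proof.
move=> x1; have Q0 : 0 < 1 - x ^+ 2 by nra.
have dQ : is_derive x 1 (fun y : R => 1 - y ^+ 2) (0 - 2%:R * x ^+ 1 * 1).
  exact: (derB (der_cst 1 x) (derX 2 (der_id x))).
have := derX n (@der_comp Num.sqrt (fun y => 1 - y ^+ 2) _ _ _ (is_derive1_sqrt Q0) dQ).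
move/der_ext; apply => //; rewrite /sinpow.
set s := Num.sqrt (1 - x ^+ 2).
have s0 : s != 0 by rewrite gt_eqF// sqrtr_gt0.
have -> : 1 - x ^+ 2 = s ^+ 2 by rewrite sqr_sqrtr// ltW.
by case: n => [|n]; rewrite /= ?exprS; field.
Qed.

End RealCalculus.

(** * The radial equation as a first-order equation *)

Section Flux.
Context {R : realType}.
Implicit Types (f g h : R -> R) (x y : R) (n : nat).

(* In the variable x = cos r, a radial function w satisfies - Lap w = g iff its
   derivative h = w' satisfies (1 - x^2) h' = n x h - g. *)
Definition is_flux n (x0 : R) g h :=
  forall x, x0 < x < 1 -> is_derive x 1 h ((n%:R * x * h x - g x) / (1 - x ^+ 2)).

(** [sinpow n] is the integrating factor. For h = w' the product is - sin^(n-1)(r) dw/dr, the flux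
    through a geodesic sphere, and this is the divergence form of the equation. *)
Lemma der_sinpow_flux n x0 g h x : -1 <= x0 -> is_flux n x0 g h -> x0 < x < 1 ->
  is_derive x 1 (fun y => sinpow n y * h y) (- (sinpow n x * g x / (1 - x ^+ 2))).
Proof.
move=> x00 gh xx; have x1 : -1 < x < 1 by lra.
have Q0 : 1 - x ^+ 2 != 0 by rewrite gt_eqF//; nra.
by apply: der_ext (derM (der_sinpow n x1) (gh _ xx)) _ _ => //; field.
Qed.

(** The product [sinpow n y * h y] is nonincreasing and vanishes at y = 1. Continuity of [h] at 1 is
    what excludes the homogeneous solutions, multiples of 1 / [sinpow n], which are singular at the
    centre. *)
Lemma flux_ge0 n x0 g h : (0 < n)%N -> -1 <= x0 -> is_flux n x0 g h ->
  (forall x, x0 < x < 1 -> 0 <= g x) -> {for 1, continuous h} ->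
  forall x, x0 < x < 1 -> 0 <= h x.
Proof.
move=> n0 x00 gh g0 h1 x xx.
have sx : 0 < sinpow n x by apply: sinpow_gt0; lra.
rewrite -(pmulr_rge0 _ sx) -oppr_le0 -[leRHS]oppr0 -(mul0r (h 1)) -(sinpow1 n0).
apply: (@der_mono _ (fun y => - (sinpow n y * h y))
  (fun y => - - (sinpow n y * g y / (1 - y ^+ 2)))).
- by lra.
- by move=> y xy; apply: derN; apply: (der_sinpow_flux x00 gh); lra.
- move=> y xy; rewrite opprK divr_ge0 ?mulr_ge0//.
  + by apply/ltW/sinpow_gt0; lra.
  + by apply: g0; lra.
  + by nra.
- move=> y /andP[xy].
  rewrite le_eqVlt => /predU1P[->|y1].
    by apply: contN; apply: contM => //; exact: sinpow_continuous.
  apply: contN; apply: contM; first exact: sinpow_continuous.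
  by apply: der_continuous (gh y _); lra.
Qed.

Lemma flux_le n x0 g1 g2 h1 h2 : (0 < n)%N -> -1 <= x0 ->
  is_flux n x0 g1 h1 -> is_flux n x0 g2 h2 ->
  {for 1, continuous h1} -> {for 1, continuous h2} ->
  (forall x, x0 < x < 1 -> g1 x <= g2 x) ->
  forall x, x0 < x < 1 -> h1 x <= h2 x.
Proof.
move=> n0 x00 f1 f2 c1 c2 g12 x xx; rewrite -subr_ge0.
apply: (@flux_ge0 n x0 (fun x => g2 x - g1 x) (fun x => h2 x - h1 x)) => //.
- move=> y xy; apply: der_ext (derB (f2 y xy) (f1 y xy)) _ _ => //.
  have Q0 : 1 - y ^+ 2 != 0 by rewrite gt_eqF//; nra.
  by field.
- by move=> y xy; rewrite subr_ge0 g12.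
- exact: contB.
Qed.

(** The linear functions w = k x are the barriers behind the Lipschitz bound and the strict
    positivity of radial solutions. *)
Lemma flux_cst n x0 (k : R) : is_flux n x0 (fun x => n%:R * x * k) (fun=> k).
Proof.
by move=> x _; apply: der_ext (der_cst k x) _ _ => //; rewrite subrr mul0r.
Qed.

(** The solution regular at the centre is minus the primitive of [sinpow (n - 2) * g] that vanishes
    at 1, divided by [sinpow n]. This is 0/0 at 1, and l'Hopital's rule gives the value g(1) / n,
    which is the equation itself at x = 1. *)
Lemma flux_ex n x0 g : (2 <= n)%N -> 0 < x0 < 1 -> continuous g ->
  exists h, [/\ continuous h, is_flux n x0 g h & n%:R * h 1 = g 1].
Proof.
case: n => [//|[//|n]] _ x01 gc.
have mc : continuous (fun y => sinpow n y * g y).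
  by move=> y; apply: contM; [exact: sinpow_continuous|exact: gc].
have [M M1 Md] := @primitive_ex _ _ 0 1 mc.
pose k y := - M y / sinpow n.+2 y.
pose q y := if y < 1 then k y else g 1 / n.+2%:R.
(* [q] is continuous only for positive arguments; freezing it below [x0] makes the flux continuous
   on the whole line. *)
pose h y := q (Num.max x0 y).
have n2 : n.+2%:R != 0 :> R by rewrite pnatr_eq0.
have kd y : 0 < y < 1 -> is_derive y 1 k
    ((n.+2%:R * y * k y - g y) / (1 - y ^+ 2)).
  move=> y01; have y1 : -1 < y < 1 by lra.
  have Q0 : 1 - y ^+ 2 != 0 by rewrite gt_eqF//; nra.
  have s0 : sinpow n y != 0 by rewrite gt_eqF// sinpow_gt0.
  have y0 : 0 < y by lra.
  have s20 : sinpow n.+2 y != 0 by rewrite gt_eqF// sinpow_gt0.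
  apply: der_ext (derM (derN (Md _ y0)) (derV s20 (der_sinpow _ y1))) _ _ => //.
  by rewrite /k sinpow2//; field; rewrite Q0.
have qk y : y < 1 -> q y = k y by rewrite /q => ->.
have kl : k y @[y --> 1^'-] --> g 1 / n.+2%:R.
  apply: (@lhopital_at_left _ _ (fun y => - (sinpow n y * g y)) _
    (fun y => - (n.+2%:R * y * sinpow n.+2 y) / (1 - y ^+ 2)) 0) => //.
  - by move=> y; rewrite in_itv /= => y01; apply: derN; apply: Md; lra.
  - by move=> y; rewrite in_itv /= => y01; apply: der_sinpow; lra.
  - apply: cvg_at_left_filter; rewrite -[X in _ --> X]oppr0 -M1.
    by apply: cvgN; apply: (der_continuous (Md 1 _)); lra.
  - apply: cvg_at_left_filter; rewrite -[X in _ --> X](@sinpow1 _ n.+2)//.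
    exact: sinpow_continuous.
  - move=> y; rewrite in_itv /= => y01; rewrite mulf_neq0 ?oppr_eq0 ?invr_eq0//.
      have y0 : y != 0 by rewrite gt_eqF//; lra.
      have s0 : sinpow n.+2 y != 0 by rewrite gt_eqF// sinpow_gt0//; lra.
      by apply: mulf_neq0 => //; apply: mulf_neq0.
    by rewrite gt_eqF//; nra.
  - have : g y / (n.+2%:R * y) @[y --> 1^'-] --> g 1 / (n.+2%:R * 1).
      apply: cvg_at_left_filter; apply: cvgM; first exact: gc.
      apply: cvgV; first by rewrite mulr1.
      exact: (der_continuous (derZ n.+2%:R (der_id 1))).
    rewrite mulr1; apply: cvg_trans; apply: near_eq_cvg; near=> y.
    have y01 : 0 < y < 1 by apply/andP; split; near: y;
      [exact: nbhs_left_gt|exact: nbhs_left_lt].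
    have Q0 : 1 - y ^+ 2 != 0 by rewrite gt_eqF//; nra.
    have s0 : sinpow n y != 0 by rewrite gt_eqF// sinpow_gt0//; lra.
    have y0 : y != 0 by rewrite gt_eqF//; lra.
    rewrite sinpow2; last lra.
    by move: n2; generalize (n.+2%:R : R) => N n2; field; rewrite Q0 s0 y0 n2.
have qc y : 0 < y -> {for y, continuous q}.
  move=> y0; have [y1|y1|->] := ltgtP y 1.
  - have kc : {for y, continuous k} by apply: der_continuous (kd y _); lra.
    rewrite /prop_for /continuous_at qk//; apply: cvg_trans kc.
    by apply: near_eq_cvg; near=> z; rewrite qk//; near: z; exact: lt_nbhsl.
  - rewrite /prop_for /continuous_at {2}/q ltNge (ltW y1) /=.
    apply: cvg_near_cst; near=> z; rewrite /q ltNge (_ : 1 <= z)//; apply: ltW; near: z.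
    exact: (near_gt (der_continuous (der_id y)) y1).
  - apply/left_right_continuousP; rewrite {2 4}/q ltxx; split.
      apply: cvg_trans kl; apply: near_eq_cvg; by near=> z; rewrite qk.
    apply: cvg_near_cst; apply: filterS (nbhs_right_gt 1) => z z1.
    by rewrite /q ltNge (ltW z1).
exists h; split.
- move=> y; apply: (@cont_comp _ q (Num.max x0)).
    apply: (@continuous_max _ _ (fun=> x0) id); first exact: cst_continuous.
    exact: (der_continuous (der_id y)).
  by apply: qc; rewrite lt_max; lra.
- move=> y xy; have hk z : x0 < z < 1 -> h z = k z.
    by move=> /andP[z0 z1]; rewrite /h max_r ?qk// ltW.
  rewrite hk//; apply: der_near (kd y _) _; first lra.
  by near=> z; rewrite hk//; near: z; exact: near_itvoo.
- rewrite /h max_r ?/q ?ltxx; last lra.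
  by rewrite mulrCA divff ?mulr1.
Unshelve. all: by end_near. Qed.

(* The derivative h' of a flux solves the flux equation in dimension n + 2 with
   source g' - n h, hence extends continuously to x = 1. *)
Lemma flux_C1 n x0 g g1 h : (2 <= n)%N -> 0 < x0 < 1 ->
  continuous g1 -> continuous h -> is_flux n x0 g h -> {for 1, continuous g} ->
  (forall x, x0 < x < 1 -> is_derive x 1 g (g1 x)) -> n%:R * h 1 = g 1 ->
  exists2 h1, continuous h1 & forall x, x0 < x < 1 -> is_derive x 1 h (h1 x).
Proof.
move=> n2 x01 g1c hc gh gc gd hg1.
have gc' : continuous (fun x => g1 x - n%:R * h x).
  by move=> x; apply: (@contB _ _ g1 (fun x => n%:R * h x)); [exact: g1c|apply: contZ; exact: hc].
have [J [Jc J_flux _]] := @flux_ex n.+2 x0 _ isT x01 gc'.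
exists J => // x xx.
(* By the flux equation, [E] equals sinpow (n + 2) times (h' - J), written without h'. It is
   constant and vanishes at 1, hence h' = J. *)
pose E y := sinpow n y * (n%:R * y * h y - g y) - sinpow n.+2 y * J y.
have Ed y : x0 < y < 1 -> is_derive y 1 E 0.
  move=> xy; have y1 : -1 < y < 1 by lra.
  have Q0 : 1 - y ^+ 2 != 0 by rewrite gt_eqF//; nra.
  have dk := derB (derM (derZ n%:R (der_id y)) (gh y xy)) (gd y xy).
  apply: der_ext (derB (derM (der_sinpow n y1) dk)
    (derM (der_sinpow n.+2 y1) (J_flux y xy))) _ _ => //.
  by rewrite sinpow2// -(addn2 n) natrD; field.
have E1 : E 1 = 0.
  by rewrite /E !sinpow1// ?mul0r ?subr0//; apply: leq_trans n2.
have Ex : E x = 0.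
  rewrite -E1; apply: der_const; first lra.
    by move=> y xy; apply: Ed; lra.
  move=> y /andP[xy]; rewrite le_eqVlt => /predU1P[->|y1]; last first.
    by apply: der_continuous (Ed y _); lra.
  apply: contB; apply: contM; [exact: sinpow_continuous| |
    exact: sinpow_continuous|exact: Jc].
  apply: contB => //; apply: contM; last exact: hc.
  exact: (der_continuous (derZ n%:R (der_id 1))).
have x1 : -1 < x < 1 by lra.
have Q0 : 1 - x ^+ 2 != 0 by rewrite gt_eqF//; nra.
apply: der_ext (gh x xx) _ _ => //.
have s0 : sinpow n x != 0 by rewrite gt_eqF// sinpow_gt0.
apply: (mulfI s0); apply: (mulfI Q0); move/eqP: Ex.
rewrite /E sinpow2// subr_eq0 => /eqP Ex.
transitivity (sinpow n x * (n%:R * x * h x - g x)); first by field.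
by rewrite Ex; ring.
Qed.

End Flux.

(** * Existence of radial solutions *)

Section RadialSolution.
Context {R : realType} (n : nat) (x0 lam B : R) (f f1 V V1 V2 : R -> R).
Implicit Types (x y a b : R).
Hypothesis n2 : (2 <= n)%N.
Hypothesis x01 : 0 < x0 < 1.
Hypothesis lam0 : 0 < lam.
Hypothesis fd : forall y, 0 <= y -> is_derive y 1 f (f1 y).
Hypothesis f1c : forall y, 0 <= y -> {for y, continuous f1}.
Hypothesis fm : forall a b, 0 <= a -> a <= b -> f a <= f b.
Hypothesis f0 : 0 < f 0.
Hypothesis Vd : forall x, x0 <= x <= 1 -> is_derive x 1 V (V1 x).
Hypothesis V1d : forall x, x0 <= x <= 1 -> is_derive x 1 V1 (V2 x).
Hypothesis V0 : forall x, x0 <= x <= 1 -> 0 <= V x.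
Hypothesis VB : forall x, x0 <= x <= 1 -> V x <= B.
Hypothesis Vsup : forall x, x0 < x < 1 ->
  lam * f (V x) <= n%:R * x * V1 x - (1 - x ^+ 2) * V2 x.

(** Chosen so that the barrier C x has source n x C >= n x0 C = lam f(B), which dominates lam f(v)
    for every v <= V <= B. It is the common Lipschitz constant. *)
Let C := lam * f B / (n%:R * x0).
Let clamp (x : R) := Num.min 1 (Num.max x0 x).

Let nR : 2 <= n%:R :> R. Proof. by rewrite ler_nat. Qed.

Let clampP x : x0 <= clamp x <= 1.
Proof.
have x01' := x01; rewrite /clamp ge_min lexx le_min le_max lexx /= andbT; lra.
Qed.

Let clampE x : x0 <= x <= 1 -> clamp x = x.
Proof. by move=> /andP[xx x1]; rewrite /clamp max_r ?min_r. Qed.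

Let clampK x : clamp (clamp x) = clamp x.
Proof. by rewrite clampE. Qed.

Let clamp_lip x y : `|clamp x - clamp y| <= `|x - y|.
Proof.
rewrite ler_norml; have := ler_norm (x - y); have := ler_norm (y - x).
rewrite (distrC y x); set d := `|_|; move=> d1 d2; have x01' := x01.
rewrite /clamp; case: (leP x0 x) => ?; [case: (leP 1 x)|case: (leP 1 x0)] => ?;
case: (leP x0 y) => ?; [case: (leP 1 y)|case: (leP 1 x0)
  |case: (leP 1 y)|case: (leP 1 x0)|case: (leP 1 y)|case: (leP 1 x0)
  |case: (leP 1 y)|case: (leP 1 x0)] => ?; lra.
Qed.

Let B0 : 0 <= B.
Proof.
have x01' := x01; have x0I : x0 <= x0 <= 1 by lra.
exact: le_trans (V0 x0I) (VB x0I). Qed.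

Let fpos y : 0 <= y -> 0 < f y.
Proof. by move=> y0; apply: lt_le_trans f0 _; exact: fm. Qed.

Let C0 : 0 < C.
Proof.
have n0 := nR; have x01' := x01.
by rewrite divr_gt0// mulr_gt0 ?fpos ?B0//; lra.
Qed.

(** All four conditions pass to pointwise suprema. The Lipschitz bound keeps the supremum
    continuous, so that it is again an admissible source; the last condition makes a function on
    [x0, 1] total by constant extension. *)
Let adm (v : R -> R) := [/\ forall x, 0 <= v x,
  forall x y, v x <= v y + C * `|x - y|, forall x, x0 <= x <= 1 -> v x <= V x
  & forall x, v x = v (clamp x)].

(** The solution operator as a relation: [z] has zero boundary value and flux [h]. The value of [h]
    at 1 is recorded because the flux equation says nothing at x = 1, where it is needed for
    second-order regularity. *)
Let isT (v z : R -> R) := exists h W : R -> R,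
  [/\ continuous h, is_flux n x0 (fun x => lam * f (v x)) h,
      n%:R * h 1 = lam * f (v 1), W x0 = 0 /\ (forall x, 0 < x -> is_derive x 1 W (h x))
      & z = fun x => W (clamp x)].

Let adm_continuous v : adm v -> continuous v.
Proof.
move=> [_ vL _ _] x; apply/cvgrPdist_lt => e e0; near=> y.
apply: (@le_lt_trans _ _ (C * `|x - y|)).
  rewrite ler_norml; have := vL x y; have := vL y x; rewrite (distrC y x); lra.
rewrite mulrC -ltr_pdivlMr; last exact: C0.
by near: y; exists (e / C) => //=; exact: (divr_gt0 e0 C0).
Unshelve. all: by end_near. Qed.

Let source_continuous v : adm v -> continuous (fun x => lam * f (v x)).
Proof.
move=> av x; have [v0 _ _ _] := av; apply: contZ; apply: cont_comp.
  exact: adm_continuous.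
exact: der_continuous (fd (v0 x)).
Qed.

Let W_mono (W W' h h' : R -> R) a b : x0 <= a -> a <= b -> b <= 1 ->
  (forall x, x0 <= x <= 1 -> is_derive x 1 W (h x)) ->
  (forall x, x0 <= x <= 1 -> is_derive x 1 W' (h' x)) ->
  (forall x, x0 < x < 1 -> h x <= h' x) -> W b - W a <= W' b - W' a.
Proof.
move=> xa ab b1 Wd Wd' hh'; suff : W' a - W a <= W' b - W b by lra.
apply: (@der_mono _ (fun x => W' x - W x) (fun x => h' x - h x)) => //.
- by move=> x xx; apply: derB; [apply: Wd'|apply: Wd]; lra.
- by move=> x xx; rewrite subr_ge0 hh'//; lra.
- move=> x xx; have xI : x0 <= x <= 1 by lra.
  exact: der_continuous (derB (Wd' x xI) (Wd x xI)).
Qed.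

Let T_mono v1 v2 z1 z2 : adm v1 -> adm v2 -> isT v1 z1 -> isT v2 z2 ->
  (forall x, v1 x <= v2 x) -> forall x, z1 x <= z2 x.
Proof.
move=> a1 a2 [h1 [W1 [h1c h1f _ [W10 W1d] ->]]] [h2 [W2 [h2c h2f _ [W20 W2d] ->]]] v12 x; have x01' := x01.
have n0 : (0 < n)%N by exact: leq_trans n2.
have x00 : -1 <= x0 by lra.
have hh := @flux_le _ n x0 _ _ h1 h2 n0 x00 h1f h2f (h1c 1) (h2c 1).
have /andP[xc xc1] := clampP x.
have := @W_mono W1 W2 h1 h2 x0 (clamp x) (lexx _) xc xc1.
rewrite W10 W20 !subr0; apply => [y yy|y yy|].
- by apply: W1d; lra.
- by apply: W2d; lra.
- apply: hh => y yy; rewrite ler_pM2l//; apply: fm => //.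
  by have [] := a1.
Qed.

(** The lattice is stable by three comparisons of the new flux: with 0 for the sign, with the
    constant [C] for the Lipschitz bound, and with [V1] for z <= V. The last uses that [V1] is
    itself a flux whose source dominates lam f(V). *)
Let T_ex v : adm v -> exists2 z, isT v z & adm z.
Proof.
move=> av; have [v0 vL vV vc] := av; have x01' := x01.
have n0 : (0 < n)%N by exact: leq_trans n2.
have x00 : -1 <= x0 by lra.
have [h [hc hf h1]] := flux_ex n2 x01 (source_continuous av).
have [W W0 Wd] := primitive_ex 0 x0 hc.
have WdI x : x0 <= x <= 1 -> is_derive x 1 W (h x) by move=> xx; apply: Wd; lra.
have hge0 : forall x, x0 < x < 1 -> 0 <= h x.
  apply: (flux_ge0 n0 x00 hf _ (hc 1)) => x xx.
  by rewrite mulr_ge0 ?ltW// fpos.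
have hleC : forall x, x0 < x < 1 -> h x <= C.
  have Cc := der_continuous (der_cst C 1).
  suff fC : forall x, x0 < x < 1 -> lam * f (v x) <= n%:R * x * C.
    by move=> x; have /(_ x) := flux_le n0 x00 hf (@flux_cst _ n x0 C) (hc 1) Cc fC.
  move=> x xx; have xI : x0 <= x <= 1 by lra.
  have fB : lam * f (v x) <= lam * f B.
    by rewrite ler_pM2l// fm//; apply: le_trans (vV _ xI) (VB xI).
  apply: (le_trans fB); rewrite /C mulrA ler_pdivlMr; last first.
    have n0R := nR; nra.
  have fB0 : 0 < lam * f B by rewrite mulr_gt0// fpos.
  rewrite mulrC ler_pM2r// ler_wpM2l//; lra.
have hleV : forall x, x0 < x < 1 -> h x <= V1 x.
  apply: (@flux_le _ n x0 _ (fun x => n%:R * x * V1 x - (1 - x ^+ 2) * V2 x) h V1 n0 x00 hf _ (hc 1)).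
  - move=> x xx; have xI : x0 <= x <= 1 by lra.
    apply: der_ext (V1d xI) _ _ => //.
    have Q0 : 1 - x ^+ 2 != 0 by rewrite gt_eqF//; nra.
    by field.
  - by apply: der_continuous (V1d _); lra.
  - move=> x xx; apply: le_trans (Vsup xx); rewrite ler_pM2l// fm// vV//; lra.
have Wm a b : x0 <= a -> a <= b -> b <= 1 -> 0 <= W b - W a <= C * (b - a).
  move=> xa ab b1; apply/andP; split.
    have := @W_mono (fun=> 0) W (fun=> 0) h a b xa ab b1.
    rewrite subrr; apply => // x _; exact: der_cst.
  have := @W_mono W (fun x => C * x) h (fun=> C) a b xa ab b1 WdI.
  rewrite -mulrBr; apply => // x _.
  by apply: der_ext (derZ C (der_id x)) _ _ => //; rewrite mulr1.
have WL a b : x0 <= a <= 1 -> x0 <= b <= 1 -> W a <= W b + C * `|a - b|.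
  move=> aI bI; case: (leP a b) => ab.
    have /andP[H _] : 0 <= W b - W a <= C * (b - a) by apply: Wm; lra.
    have : 0 <= C * `|a - b| by rewrite mulr_ge0// ltW// C0.
    lra.
  have /andP[_ H] : 0 <= W a - W b <= C * (a - b) by apply: Wm; lra.
  by rewrite ger0_norm; lra.
exists (fun x => W (clamp x)); first by exists h, W.
split.
- move=> x; have /andP[xc xc1] := clampP x.
  by have := Wm _ _ (lexx _) xc xc1; rewrite W0; lra.
- move=> x y; apply: le_trans (WL _ _ (clampP x) (clampP y)) _.
  by rewrite lerD2l ler_pM2l ?clamp_lip//; exact: C0.
- move=> x xx; rewrite clampE//; have /andP[xa xb] := xx.
  have x0I : x0 <= x0 <= 1 by lra.
  have := @W_mono W V h V1 x0 x (lexx _) xa xb WdI Vd hleV.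
  by have := V0 x0I; rewrite W0; lra.
- by move=> x; rewrite clampK.
Qed.

Let fixpoint : exists2 w, adm w & isT w w.
Proof.
pose S := [set v | adm v /\ exists2 z, isT v z & forall x, v x <= z x].
have S0 : S (fun=> 0).
  have a0 : adm (fun=> 0).
    split=> // x y; rewrite add0r mulr_ge0// ltW//; exact: C0.
  split=> //; have [z Tz [z0 _ _ _]] := T_ex a0.
  by exists z.
pose A x := [set v x | v in S].
have A0 x : A x !=set0 by exists 0; exists (fun=> 0).
have AB x : has_ubound (A x).
  exists B => _ [v [[_ _ vV vc] _] <-]; rewrite vc.
  exact: le_trans (vV _ (clampP x)) (VB (clampP x)).
pose w x := sup (A x).
have vw v x : S v -> v x <= w x by move=> Sv; apply: ub_le_sup => //; exists v.
have aw : adm w.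
  split.
  - by move=> x; exact: (vw (fun=> 0)).
  - move=> x y; apply: ge_sup => // _ [v Sv <-].
    have [[_ vL _ _] _] := Sv; apply: le_trans (vL x y) _.
    by rewrite lerD2r vw.
  - by move=> x xx; apply: ge_sup => // _ [v [[_ _ vV _] _] <-]; exact: vV.
  - move=> x; rewrite /w; congr sup; apply/seteqP; split=> _ [v Sv <-].
      by have [[_ _ _ vc] _] := Sv; exists v => //; rewrite -vc.
    by have [[_ _ _ vc] _] := Sv; exists v => //; rewrite -vc.
have [z Tz az] := T_ex aw.
(* By monotonicity every [v] of [S] lies below its image, hence below the image [z] of the supremum.
   Then [z] belongs to [S] too, which gives the reverse inequality. *)
have wz x : w x <= z x.
  apply: ge_sup => // _ [v Sv <-]; have [av [u Tu vu]] := Sv.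
  apply: le_trans (vu x) _; apply: (T_mono av aw Tu Tz) => y; exact: vw.
have Sz : S z.
  split=> //; have [z' Tz' _] := T_ex az; exists z' => //.
  exact: (T_mono aw az Tz Tz').
have wzE : w = z.
  by apply/funext => x; apply/eqP; rewrite eq_le wz; exact: vw.
by exists w => //; move: Tz; rewrite -wzE.
Qed.

(* Knaster-Tarski: the solution is the supremum of the C-Lipschitz functions
   0 <= v <= V with v <= T v, where T v solves - Lap (T v) = lam f(v). *)
Lemma radial_solution : exists w w1 w2 : R -> R,
  [/\ forall x, x0 / 2 < x -> is_derive x 1 w (w1 x),
      forall x, x0 / 2 < x -> is_derive x 1 w1 (w2 x) /\ {for x, continuous w2},
      w x0 = 0, forall x, x0 < x <= 1 -> 0 < w x <= V x
    & forall x, x0 < x <= 1 -> n%:R * x * w1 x - (1 - x ^+ 2) * w2 x = lam * f (w x)].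
Proof.
have [u au [h [W [hc hf h1 [W0 Wd] uE]]]] := fixpoint.
have [u0 uL uV _] := au; have x01' := x01.
have uW x : x0 <= x <= 1 -> u x = W x by move=> xx; rewrite uE clampE.
have n0 : (0 < n)%N by exact: leq_trans n2.
have x00 : -1 <= x0 by lra.
(* Bootstrap: the fixed point is only known to be Lipschitz, but it is a primitive of [h], so its
   source is C^1 and [flux_C1] makes [h] itself C^1. *)
pose g1 x := lam * (f1 (u x) * h x).
have g1c : continuous g1.
  move=> x; apply: (@contZ _ _ lam (fun y => f1 (u y) * h y)).
  apply: contM; last exact: hc.
  by apply: cont_comp; [exact: adm_continuous|exact: f1c].
have gd x : x0 < x < 1 -> is_derive x 1 (fun y => lam * f (u y)) (g1 x).
  move=> xx; apply: derZ; apply: der_comp; first exact: fd.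
  apply: (@der_near _ W); first by apply: Wd; lra.
  near=> y; rewrite uW//; have yy : x0 < y < 1 by near: y; exact: near_itvoo.
  lra.
have [k kc kd] := flux_C1 n2 x01 g1c hc hf (source_continuous au (x := 1)) gd h1.
have [K K1 Kd] := primitive_ex 0 1 kc.
pose w1 x := K x + h 1.
have w1d x : 0 < x -> is_derive x 1 w1 (k x).
  by move=> xx; apply: der_ext (derD (Kd x xx) (der_cst (h 1) x)) _ _ => //; rewrite addr0.
have w1h x : x0 < x <= 1 -> w1 x = h x.
  move=> xx; apply/eqP; rewrite -subr_eq0; apply/eqP.
  have -> : 0 = w1 1 - h 1 by rewrite /w1 K1 add0r subrr.
  apply: (@der_const _ (fun x => w1 x - h x)); first lra.
    move=> y yy; have y0 : 0 < y by lra.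
    have y1 : x0 < y < 1 by lra.
    by apply: der_ext (derB (w1d y y0) (kd y y1)) _ _ => //; rewrite subrr.
  move=> y yy; apply: contB; last exact: hc.
  by apply: der_continuous (w1d y _); lra.
(* [u] is constant outside [x0, 1] and thus not smooth at [x0]. Integrating [w1], which is
   differentiable on all positive x, extends the solution smoothly past both ends; [D] only supplies
   the global continuity that [primitive_ex] asks for. *)
pose D x := Num.max x (x0 / 2).
have w1c : continuous (fun x => w1 (D x)).
  move=> x; apply: (@cont_comp _ w1 D).
    apply: (@continuous_max _ _ id (fun=> x0 / 2)); last exact: cst_continuous.
    exact: (der_continuous (der_id x)).
  by apply: der_continuous (w1d _ _); rewrite lt_max; apply/orP; right; lra.
have [w wx0 wd'] := primitive_ex (x0 / 2) x0 w1c.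
have x2 : 0 < x0 / 2 < x0 by lra.
have D_id x : x0 / 2 < x -> D x = x by move=> xx; rewrite /D max_l// ltW.
have wd x : x0 / 2 < x -> is_derive x 1 w (w1 x).
  by move=> xx; rewrite -{2}(D_id x)//; exact: wd'.
have wW x : x0 <= x <= 1 -> w x = W x.
  move=> xx; apply/eqP; rewrite -subr_eq0; apply/eqP.
  have -> : 0 = w x0 - W x0 by rewrite wx0 W0 subrr.
  apply/esym; apply: (@der_const _ (fun x => w x - W x)); first lra.
    move=> y yy; have y0 : 0 < y by lra.
    have y2 : x0 / 2 < y by lra.
    apply: der_ext (derB (wd y y2) (Wd y y0)) _ _ => //.
    by rewrite w1h ?subrr//; lra.
  move=> y yy; apply: contB.
    by apply: der_continuous (wd y _); lra.
  by apply: der_continuous (Wd y _); lra.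
exists w, w1, k; split=> //.
- by move=> x xx; split; [apply: w1d; lra|exact: kc].
- move=> x xx; have xI : x0 <= x <= 1 by lra.
  rewrite wW// -uW// uV// andbT uW//.
  (* The barrier m x has source n y m <= lam f(0), so the solution grows at least like m (x - x0):
     this is strict positivity. *)
  pose m := lam * f 0 / n%:R.
  have n0R : 0 < n%:R :> R by have := nR; lra.
  have m0 : 0 < m by rewrite divr_gt0// mulr_gt0.
  have hm : forall y, x0 < y < 1 -> m <= h y.
    have mc := der_continuous (der_cst m 1).
    suff fm0 : forall y, x0 < y < 1 -> n%:R * y * m <= lam * f (u y).
      by move=> y; have /(_ y) := flux_le n0 x00 (@flux_cst _ n x0 m) hf mc (hc 1) fm0.
    move=> y yy.
    have : lam * f 0 <= lam * f (u y) by rewrite ler_pM2l// fm.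
    apply: le_trans; rewrite /m mulrC mulrA divfK ?gt_eqF//.
    by rewrite ler_piMr// ?mulr_ge0 ?ltW//; lra.
  have := @W_mono (fun x => m * x) W (fun=> m) h x0 x (lexx _) _ _ _ _ hm.
  rewrite W0 subr0 -mulrBr => H.
  apply: (@lt_le_trans _ _ (m * (x - x0))); first by rewrite mulr_gt0//; lra.
  apply: H; [lra|lra| |by move=> y yy; apply: Wd; lra].
  by move=> y yy; apply: der_ext (derZ m (der_id y)) _ _ => //; rewrite mulr1.
(* At x = 1 the second-order term drops out and the equation is the recorded identity n h(1) = lam
   f(u(1)); for x < 1 it is the flux equation. *)
- move=> x /andP[xx]; rewrite le_eqVlt => /predU1P[->|x1].
    rewrite w1h ?expr1n ?subrr ?mul0r ?subr0 ?mulr1 ?h1; last lra.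
    by rewrite wW ?uW//; lra.
  have xI : x0 < x < 1 by lra.
  have Q0 : 1 - x ^+ 2 != 0 by rewrite gt_eqF//; nra.
  have kE : k x = (n%:R * x * h x - lam * f (u x)) / (1 - x ^+ 2).
    by rewrite -(@derive_val _ _ _ _ _ _ _ (kd x xI)) (@derive_val _ _ _ _ _ _ _ (hf x xI)).
  rewrite w1h ?kE ?wW ?uW; [by field|lra..].
Unshelve. all: by end_near. Qed.

End RadialSolution.

(** * Calculus on the sphere *)

Section Sphere.
Context {R : realType} {k : nat}.
Implicit Types (x y c p : 'rV[R]_k) (w : R -> R) (i j : 'I_k).

Lemma edot_continuous c : continuous (fun x => edot x c).
Proof.
move=> x; rewrite /edot; apply: continuous_big; first exact: add_continuous.
move=> i _ {}x; apply: (@contM _ _ (fun x : 'rV[R]_k => x ord0 i) (fun=> c ord0 i)).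
  exact: coord_continuous.
exact: cst_continuous.
Qed.

Lemma edotC x y : edot x y = edot y x.
Proof. by apply: eq_bigr => i _; rewrite mulrC. Qed.

Lemma edotDl x y c : edot (x + y) c = edot x c + edot y c.
Proof. by rewrite -big_split; apply: eq_bigr => i _; rewrite mxE mulrDl. Qed.

Lemma edotZl a x y : edot (a *: x) y = a * edot x y.
Proof. by rewrite mulr_sumr; apply: eq_bigr => i _; rewrite mxE mulrA. Qed.

Lemma edot_basis i x : edot (ebasis R i) x = x ord0 i.
Proof.
rewrite /edot (bigD1 i)//= mxE !eqxx mul1r big1 ?addr0// => j ji.
by rewrite mxE (negbTE ji) andbF mul0r.
Qed.

Lemma edot_ge0 x : 0 <= edot x x.
Proof. by apply: sumr_ge0 => i _; rewrite -expr2 sqr_ge0. Qed.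

Lemma edot_gt0 x : (0 < edot x x) = (x != 0).
Proof.
rewrite lt_neqAle edot_ge0 andbT eq_sym; congr negb.
apply/eqP/eqP => [x0|->]; last by rewrite /edot big1// => i _; rewrite mxE mul0r.
apply/rowP => i; rewrite mxE; apply/eqP; rewrite -sqrf_eq0 expr2; apply/eqP.
apply: (psumr_eq0P (F := fun i => x ord0 i * x ord0 i) _ x0) => // j _.
by rewrite -expr2 sqr_ge0.
Qed.

Lemma edot_sphere_le1 x c : on_sphere x -> on_sphere c -> -1 <= edot x c <= 1.
Proof.
rewrite /on_sphere => xx cc.
have E a : edot (x + a *: c) (x + a *: c) = 1 + 2 * a * edot x c + a ^+ 2.
  by rewrite edotDl edotZl !(edotC _ (x + _)) !edotDl !edotZl xx cc (edotC c x); ring.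
by have := edot_ge0 (x + 1 *: c); have := edot_ge0 (x + (-1) *: c); rewrite !E; lra.
Qed.

Lemma edot_sphere_eq1 x c : on_sphere x -> on_sphere c -> edot x c = 1 -> x = c.
Proof.
rewrite /on_sphere => xx cc xc; apply/eqP; rewrite -subr_eq0; apply: contraT.
rewrite -edot_gt0 -scaleN1r !(edotDl, edotZl, edotC _ (x + _)).
by rewrite xx cc (edotC c x) xc; lra.
Qed.

Lemma on_sphere_normalize x : x != 0 -> on_sphere ((enorm x)^-1 *: x).
Proof.
rewrite -edot_gt0 => x0; rewrite /on_sphere edotZl edotC edotZl mulrA -expr2.
by rewrite exprVn sqr_sqrtr ?ltW// mulVf// gt_eqF.
Qed.

Lemma enorm_sphere x : on_sphere x -> enorm x = 1.
Proof. by rewrite /on_sphere /enorm => ->; rewrite sqrtr1. Qed.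

Lemma on_sphere_neq0 x : on_sphere x -> x != 0.
Proof. by rewrite /on_sphere -edot_gt0 => ->. Qed.

Lemma hext_sphere u x : on_sphere x -> hext u x = u x.
Proof. by rewrite /hext => /enorm_sphere ->; rewrite invr1 scale1r. Qed.

Lemma edot2_continuous : continuous (fun x => edot x x).
Proof.
move=> x; rewrite /edot; apply: continuous_big; first exact: add_continuous.
move=> i _ {}x; apply: (@contM _ _ (fun x : 'rV[R]_k => x ord0 i) (fun x => x ord0 i));
  exact: coord_continuous.
Qed.

Lemma enorm_continuous : continuous (@enorm R k).
Proof.
move=> x; rewrite /enorm; apply: (@continuous_comp _ _ _ (fun x => edot x x) Num.sqrt).
  exact: edot2_continuous.
exact: sqrt_continuous.
Qed.

Lemma enorm_gt0 x : (0 < enorm x) = (x != 0).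
Proof. by rewrite sqrtr_gt0 edot_gt0. Qed.

(* cosine of the angle between x and c, when c is a unit vector *)
Definition cosang c x : R := edot x c / enorm x.

Lemma cosang_normalize c x : edot ((enorm x)^-1 *: x) c = cosang c x.
Proof. by rewrite edotZl mulrC. Qed.

Lemma cosang_sphere c x : on_sphere x -> cosang c x = edot x c.
Proof. by move=> xs; rewrite /cosang enorm_sphere// divr1. Qed.

Lemma cosang_continuous c x : x != 0 -> {for x, continuous (cosang c)}.
Proof.
rewrite -enorm_gt0 => x0; apply: contM; first exact: edot_continuous.
by apply: contV; [rewrite gt_eqF|exact: enorm_continuous].
Qed.

(** Ambient derivatives are pulled back to a line, where the one-variable rules apply. *)
Lemma is_deriveE1 (f : 'rV[R]_k -> R) x v df :
  is_derive x v f df <-> is_derive (0 : R) 1 (fun t : R => f (t *: v + x)) df.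
Proof.
suff E : 'D_1 (fun t : R => f (t *: v + x)) 0 = 'D_v f x.
  split=> -[d e]; split.
  - exact: ((derivable1P f x v).1 d).
  - by rewrite E.
  - exact: ((derivable1P f x v).2 d).
  - by rewrite -E.
rewrite /derive; set g1 := fun h => h^-1 *: _; set g2 := fun h => h^-1 *: _.
suff -> : g1 = g2 by [].
by rewrite funeqE /g1 /g2 => h /=; rewrite addr0 scale0r add0r [_%:A]mulr1.
Qed.

Definition dcosang c i x : R := (c ord0 i - cosang c x * (x ord0 i / enorm x)) / enorm x.

Definition ddcosang c i j x : R :=
  - (dcosang c j x * (x ord0 i / enorm x)
     + cosang c x * ((i == j)%:R - x ord0 i * x ord0 j / enorm x ^+ 2) / enorm x) / enorm x
  - (c ord0 i - cosang c x * (x ord0 i / enorm x)) * x ord0 j / enorm x ^+ 3.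

Lemma derive_coord i j x :
  is_derive (0 : R) 1 (fun t : R => (t *: ebasis R j + x) ord0 i) ((i == j)%:R).
Proof.
have E : (fun t : R => (t *: ebasis R j + x) ord0 i) =1 (fun t => (i == j)%:R * t + x ord0 i).
  by move=> t; rewrite !mxE eqxx /= mulrC.
rewrite (funext E); apply: der_ext (derD (derZ (i == j)%:R (der_id 0)) (der_cst (x ord0 i) 0)) _ _ => //.
by rewrite mulr1 addr0.
Qed.

Lemma derive_enorm j x : x != 0 ->
  is_derive (0 : R) 1 (fun t : R => enorm (t *: ebasis R j + x)) (x ord0 j / enorm x).
Proof.
move=> x0; have q0 : 0 < edot x x by rewrite edot_gt0.
pose q (t : R) := edot x x + 2 * x ord0 j * t + t ^+ 2.
have qE t : edot (t *: ebasis R j + x) (t *: ebasis R j + x) = q t.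
  rewrite edotDl edotZl !(edotC _ (_ + x)) !edotDl !edotZl !edot_basis (edotC x) !edot_basis.
  by rewrite !mxE !eqxx /q /=; ring.
rewrite /enorm (funext (fun t => congr1 Num.sqrt (qE t))).
have q0E : q 0 = edot x x by rewrite /q expr0n mulr0 !addr0.
have dq : is_derive (0 : R) 1 q (2 * x ord0 j).
  apply: der_ext (derD (derD (der_cst (edot x x) 0) (derZ (2 * x ord0 j) (der_id 0)))
    (derX 2 (der_id 0))) _ _ => //.
  by rewrite expr1; ring.
have sq : is_derive (q 0) 1 Num.sqrt (2 * Num.sqrt (q 0))^-1.
  by apply: is_derive1_sqrt; rewrite q0E.
apply: der_ext (der_comp sq dq) _ _ => //; rewrite q0E.
have s0 : Num.sqrt (edot x x) != 0 by rewrite gt_eqF// sqrtr_gt0.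
by field.
Qed.

Lemma derive_edot c i x :
  is_derive (0 : R) 1 (fun t : R => edot (t *: ebasis R i + x) c) (c ord0 i).
Proof.
have E : (fun t : R => edot (t *: ebasis R i + x) c) =1 (fun t => c ord0 i * t + edot x c).
  by move=> t; rewrite edotDl edotZl edot_basis mulrC.
rewrite (funext E); apply: der_ext (derD (derZ (c ord0 i) (der_id 0)) (der_cst (edot x c) 0)) _ _ => //.
by rewrite mulr1 addr0.
Qed.

Lemma is_derive_cosang c i x : x != 0 ->
  is_derive x (ebasis R i) (cosang c) (dcosang c i x).
Proof.
move=> x0; apply/is_deriveE1; rewrite /cosang.
have n0 : enorm x != 0 by rewrite gt_eqF// enorm_gt0.
have e0 : 0 *: ebasis R i + x = x by rewrite scale0r add0r.
have n0' : enorm (0 *: ebasis R i + x) != 0 by rewrite e0.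
apply: der_ext (derM (derive_edot c i x) (@derV _ (fun t : R => enorm (t *: ebasis R i + x)) _ _ n0' (derive_enorm i x0))) _ _ => //.
by rewrite e0 /dcosang /cosang; field.
Qed.

Lemma is_derive_dcosang c i j x : x != 0 ->
  is_derive x (ebasis R j) (dcosang c i) (ddcosang c i j x).
Proof.
move=> x0; apply/is_deriveE1; rewrite /dcosang.
have n0 : enorm x != 0 by rewrite gt_eqF// enorm_gt0.
have e0 : 0 *: ebasis R j + x = x by rewrite scale0r add0r.
have n0' : enorm (0 *: ebasis R j + x) != 0 by rewrite e0.
have dV := @derV _ (fun t : R => enorm (t *: ebasis R j + x)) _ _ n0' (derive_enorm j x0).
have /is_deriveE1 dc := is_derive_cosang c j x0.
apply: der_ext (derM (derB (der_cst (c ord0 i) 0) (derM dc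
  (derM (derive_coord i j x) dV))) dV) _ _ => //.
by rewrite e0 /ddcosang /dcosang; field.
Qed.

Lemma is_derive_radial c w a i x : x != 0 -> is_derive (cosang c x) 1 w a ->
  is_derive x (ebasis R i) (fun y => w (cosang c y)) (a * dcosang c i x).
Proof.
move=> x0 wa; apply/is_deriveE1.
have /is_deriveE1 dc := is_derive_cosang c i x0.
apply: (@der_comp _ w (fun t : R => cosang c (t *: ebasis R i + x))) => //.
by rewrite scale0r add0r.
Qed.

Lemma hext_radial w c : hext (fun p => w (edot p c)) = fun x => w (cosang c x).
Proof. by apply/funext => x; rewrite /hext cosang_normalize. Qed.

Lemma near_neq0 x : x != 0 -> \forall y \near x, y != 0.
Proof.
rewrite -enorm_gt0 => x0; near=> y; rewrite -enorm_gt0; near: y.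
by apply: (@near_gt _ _ (@enorm R k)) => //; exact: enorm_continuous.
Unshelve. all: by end_near. Qed.

Lemma partial_radial c w w1 i x : x != 0 ->
  (\forall s \near cosang c x, is_derive (s : R) 1 w (w1 s)) ->
  \forall y \near x, is_derive y (ebasis R i) (fun y => w (cosang c y))
                        (w1 (cosang c y) * dcosang c i y).
Proof.
move=> x0 wd; have xc := cosang_continuous (c := c) x0.
have nd : \forall y \near x, is_derive (cosang c y) 1 w (w1 (cosang c y)).
  exact: (xc _ wd).
near=> y; apply: is_derive_radial; first by near: y; exact: near_neq0.
by near: y.
Unshelve. all: by end_near. Qed.

Lemma partial2_radial c w w1 a i j x : x != 0 ->
  (\forall s \near cosang c x, is_derive (s : R) 1 w (w1 s)) ->
  is_derive (cosang c x) 1 w1 a ->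
  is_derive x (ebasis R j) (partial i (fun y => w (cosang c y)))
    (a * dcosang c j x * dcosang c i x + w1 (cosang c x) * ddcosang c i j x).
Proof.
move=> x0 wd w1d.
apply: (@near_eq_is_derive _ _ _ (fun y => w1 (cosang c y) * dcosang c i y)).
  have := partial_radial i x0 wd; apply: filterS => y dy.
  by rewrite /partial (@derive_val _ _ _ _ _ _ _ dy).
have d1 := is_derive_radial j x0 w1d; have d2 := is_derive_dcosang c i j x0.
have := is_deriveM d1 d2; rewrite /GRing.scale /= => dM.
by apply: is_derive_eq dM _; rewrite addrC; congr (_ + _); rewrite mulrC.
Qed.

(** At a point of the unit sphere with s = [edot p c], the gradient of [cosang c] has squared length
    1 - s^2 and its Laplacian is - (k - 1) s, as for a spherical harmonic of degree one. The rest is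
    the chain rule. *)
Lemma elap_radial c w w1 a p : on_sphere c -> on_sphere p ->
  (\forall s \near edot p c, is_derive (s : R) 1 w (w1 s)) ->
  is_derive (edot p c) 1 w1 a ->
  elap (fun y => w (cosang c y)) p =
    (1 - edot p c ^+ 2) * a - (k%:R - 1) * edot p c * w1 (edot p c).
Proof.
move=> cs ps wd w1d; have p0 := on_sphere_neq0 ps.
rewrite -(cosang_sphere c ps) in wd w1d *.
rewrite /elap (eq_bigr (fun i => a * (dcosang c i p * dcosang c i p)
    + w1 (cosang c p) * ddcosang c i i p)); last first.
  by move=> i _; rewrite {1}/partial (derive_val (is_derive := partial2_radial i i p0 wd w1d)) mulrA.
rewrite big_split /= -!mulr_sumr /ddcosang /dcosang cosang_sphere// enorm_sphere//.
set s := edot p c.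
rewrite (eq_bigr (fun i => c ord0 i * c ord0 i - (2 * s) * (p ord0 i * c ord0 i)
  + s ^+ 2 * (p ord0 i * p ord0 i))); last by move=> i _; rewrite !divr1; ring.
rewrite [X in _ + _ * X](eq_bigr (fun i => (- 2) * (p ord0 i * c ord0 i) - s
  + (3 * s) * (p ord0 i * p ord0 i))); last by move=> i _; rewrite eqxx !expr1n !divr1 /=; ring.
rewrite !big_split /= !sumrN -!mulr_sumr sumr_const card_ord -/(edot c c) -/(edot p c) -/(edot p p).
rewrite cs ps -/s -mulr_natr; ring.
Qed.

(* Second-order directional regularity: just enough to evaluate elap at x. *)
Definition has_elap (h : 'rV[R]_k -> R) x :=
  (\forall y \near x, forall i, derivable h y (ebasis R i)) /\
  forall i, derivable (partial i h) x (ebasis R i).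

Lemma has_elap_radial c w w1 a x : x != 0 ->
  (\forall s \near cosang c x, is_derive (s : R) 1 w (w1 s)) ->
  is_derive (cosang c x) 1 w1 a -> has_elap (fun y => w (cosang c y)) x.
Proof.
move=> x0 wd w1d; split=> [|i]; last by case: (partial2_radial i i x0 wd w1d).
have xc := cosang_continuous (c := c) x0.
have nd : \forall y \near x, is_derive (cosang c y) 1 w (w1 (cosang c y)).
  exact: (xc _ wd).
apply: filterS2 nd (near_neq0 x0) => y dy y0 i.
by case: (is_derive_radial i y0 dy).
Qed.

(** One combination rule serves both uses: ws - v - M ph in the comparison, and 0 - U for a minimum
    of U. *)
Lemma has_elapB (h1 h2 : 'rV[R]_k -> R) a x : has_elap h1 x -> has_elap h2 x ->
  has_elap (fun y => h1 y - a * h2 y) x /\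
  elap (fun y => h1 y - a * h2 y) x = elap h1 x - a * elap h2 x.
Proof.
move=> [d1 dd1] [d2 dd2].
have D i y v : derivable h1 y v -> derivable h2 y v ->
    is_derive y v (fun y => h1 y - a * h2 y) ('D_v h1 y - a * 'D_v h2 y).
  move=> /derivableP e1 /derivableP e2.
  exact: (is_deriveB e1 (is_deriveZ a e2)).
have E i : \forall y \near x,
    partial i h1 y - a * partial i h2 y = partial i (fun y => h1 y - a * h2 y) y.
  apply: filterS2 d1 d2 => y /(_ i) e1 /(_ i) e2.
  by rewrite /partial (derive_val (is_derive := D i y _ e1 e2)).
have DD i : is_derive x (ebasis R i) (partial i (fun y => h1 y - a * h2 y))
    (partial i (partial i h1) x - a * partial i (partial i h2) x).
  apply: near_eq_is_derive (E i) _.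
  have /derivableP e1 := dd1 i; have /derivableP e2 := dd2 i.
  exact: (is_deriveB e1 (is_deriveZ a e2)).
split; first split=> [|i].
- apply: filterS2 d1 d2 => y d1y d2y i.
  have e1 := d1y i; have e2 := d2y i.
  by case: (D i y _ e1 e2).
- by case: (DD i).
- rewrite /elap mulr_sumr -sumrB; apply: eq_bigr => i _.
  by rewrite {1}/partial (derive_val (is_derive := DD i)).
Qed.

End Sphere.

(** * Second-order conditions at a local maximum *)

Section SecondDerivative.
Context {R : realType}.

(** The first derivative vanishes at 0. If d were positive, [g1 t / t] would be positive near 0, and
    the mean value theorem on a short interval to the right of 0 would give g(s) > g(0). *)
Lemma second_derivative_max (g g1 : R -> R) (d : R) :
  (\forall t \near (0 : R), is_derive (t : R) 1 g (g1 t)) -> is_derive (0 : R) 1 g1 d ->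
  (\forall t \near (0 : R), g t <= g 0) -> d <= 0.
Proof.
move=> gd g1d gmax.
have /nbhs_ballP[e e0 eP] : \forall t \near (0 : R), is_derive (t : R) 1 g (g1 t) /\ g t <= g 0.
  by near=> t; split; near: t.
have eb t : - e < t < e -> is_derive t 1 g (g1 t) /\ g t <= g 0.
  by move=> te; apply: eP; rewrite /ball /= sub0r normrN ltr_norml.
have g10 : g1 0 = 0.
  have d0 : is_derive (0 : R) 1 g 0.
    apply: (@derive1_at_max _ g (- e) e); rewrite ?in_itv /=; first by move: e0 => /=; lra.
    - by move=> t; rewrite in_itv /= => /eb[[]].
    - by move: e0 => /=; lra.
    - by move=> t; rewrite in_itv /= => /eb[].
  have [d0' _] : is_derive (0 : R) 1 g (g1 0) /\ g 0 <= g 0 by apply: eb; move: e0 => /=; lra.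
  by rewrite -(derive_val (is_derive := d0')) (derive_val (is_derive := d0)).
rewrite leNgt; apply/negP => dgt0.
have : \forall t \near 0^', 0 < t^-1 * (g1 t).
  have [c1 c2] := g1d; rewrite /derivable /= in c1; rewrite /derive /= in c2.
  have : (fun h : R => h^-1 *: (g1 (h *: 1 + 0) - g1 0)) @ 0^' --> d by rewrite -c2.
  move/cvgr_gt => /(_ _ dgt0); apply: filterS => t.
  by rewrite g10 subr0 addr0 [_ *: 1]mulr1.
rewrite near_withinE => /nbhs_ballP[e' e'0 e'P].
pose s := Num.min e e' / 2.
have se : 0 < s < e /\ s < e'.
  move: e0 e'0; rewrite /s /=; case: (leP e e') => ? ? ?; lra.
have s0 : 0 < s by lra.
have gd' t : t \in `]0, s[ -> is_derive t 1 g (g1 t).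
  by rewrite in_itv /= => ts; apply: (eb t _).1; lra.
have gc : {within `[0, s], continuous g}.
  by apply: within_itv_continuous => t ts; apply: der_continuous (eb t _).1; lra.
have [c] := MVT s0 gd' gc.
rewrite in_itv /= => cs E.
have gs : g s <= g 0 by apply: (eb s _).2; lra.
have g1c : 0 < g1 c.
  have : 0 < c^-1 * g1 c.
    apply: e'P; last by rewrite gt_eqF//; lra.
    by rewrite /ball /= sub0r normrN gtr0_norm; lra.
  by rewrite pmulr_rgt0// invr_gt0; lra.
by move: E; have := mulr_gt0 g1c s0; rewrite subr0; lra.
Unshelve. all: by end_near. Qed.

Lemma elap_max {k : nat} (h : 'rV[R]_k -> R) (p : 'rV[R]_k) : has_elap h p ->
  (\forall y \near p, h y <= h p) -> elap h p <= 0.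
Proof.
move=> [hd hdd] hmax; apply: sumr_le0 => i _.
have lc : {for 0, continuous (fun t : R => t *: ebasis R i + p)}.
  have : {for 0, continuous (fun t : R => t *: ebasis R i)}.
    exact: scalel_continuous.
  by move=> c1; apply: cvgD => //; exact: cvg_cst.
have e0 : 0 *: ebasis R i + p = p by rewrite scale0r add0r.
have near0 (P : 'rV[R]_k -> Prop) : (\forall y \near p, P y) ->
    \forall t \near (0 : R), P (t *: ebasis R i + p).
  by move=> nP; apply: lc; rewrite e0.
apply: (@second_derivative_max (fun t => h (t *: ebasis R i + p))
  (fun t => partial i h (t *: ebasis R i + p))).
- apply: filterS (near0 _ hd) => t /(_ i) d.
  have /is_deriveE1 := derivableP d; rewrite /partial.
  set D := 'D_ _ _ _ => dd.
  have dt : is_derive t 1 (fun s : R => s - t) 1.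
    by apply: der_ext (derB (der_id t) (der_cst t t)) _ _ => //; rewrite subr0.
  have dd' : is_derive (t - t) 1 (fun s : R => h (s *: ebasis R i + (t *: ebasis R i + p))) D.
    by rewrite subrr.
  apply: der_ext (@der_comp _ (fun s : R => h (s *: ebasis R i + (t *: ebasis R i + p)))
    (fun s : R => s - t) t _ _ dd' dt) _ _; last by rewrite mulr1.
  by move=> s; rewrite addrA -scalerDl subrK.
- by have /derivableP/is_deriveE1 := hdd i.
- by rewrite e0; exact: (near0 (fun y => h y <= h p)).
Qed.

End SecondDerivative.

(** * Geodesic balls *)

Section Ball.
Context {R : realType} {n : nat} (c : 'rV[R]_n.+1) (Rad : R).
Hypothesis cs : on_sphere c.
Hypothesis Rad0 : 0 < Rad.
Hypothesis Rad2 : Rad < pi / 2.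
Implicit Types (x p : 'rV[R]_n.+1) (s t : R).

Let Rpi : Rad \in `[0, pi].
Proof.
by rewrite in_itv /= ltW//= ltW// (lt_trans Rad2)// ltr_pdivrMr// ltr_pMr ?pi_gt0// ltr1n.
Qed.

Let acosI p : on_sphere p -> acos (edot p c) \in `[0, pi].
Proof. by move=> ps; rewrite in_itv /= acos_ge0 ?acos_lepi ?edot_sphere_le1. Qed.

Lemma cos_gdist p : on_sphere p -> cos (gdist c p) = edot p c.
Proof. by move=> ps; rewrite acosK// in_itv /= edot_sphere_le1. Qed.

Lemma gdist_lt p : on_sphere p -> (gdist c p < Rad) = (cos Rad < edot p c).
Proof. by move=> ps; rewrite -(cos_gdist ps) ltr_cos// acosI. Qed.

Lemma gdist_le p : on_sphere p -> (gdist c p <= Rad) = (cos Rad <= edot p c).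
Proof. by move=> ps; rewrite -(cos_gdist ps) !leNgt ltr_cos// acosI. Qed.

Lemma gdist_eq p : on_sphere p -> gdist c p = Rad <-> edot p c = cos Rad.
Proof.
move=> ps; split=> [<-|E]; first by rewrite cos_gdist.
by rewrite /gdist E cosK.
Qed.

Lemma gballP p : gball c Rad p <-> on_sphere p /\ cos Rad < edot p c.
Proof. by split=> -[ps H]; split=> //; move: H; rewrite gdist_lt. Qed.

Lemma gcballP p : gcball c Rad p <-> on_sphere p /\ cos Rad <= edot p c.
Proof. by split=> -[ps H]; split=> //; move: H; rewrite gdist_le. Qed.

Lemma cos_Rad : 0 < cos Rad < 1.
Proof.
rewrite cos_gt0_pihalf; last first.
  by rewrite Rad2 andbT (lt_trans _ Rad0)// oppr_lt0 divr_gt0// pi_gt0.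
by rewrite -cos0 ltr_cos// in_itv /= lexx pi_ge0.
Qed.

Lemma gball_gcone p : gball c Rad p -> gcone c Rad p.
Proof.
move=> pB; have [ps _] := pB; split; first exact: on_sphere_neq0.
by rewrite enorm_sphere// invr1 scale1r.
Qed.

Lemma gconeP x : gcone c Rad x <-> x != 0 /\ cos Rad < cosang c x.
Proof.
split=> -[x0].
  by move=> /gballP[_]; rewrite cosang_normalize.
by split=> //; apply/gballP; rewrite cosang_normalize; split=> //; exact: on_sphere_normalize.
Qed.

Lemma cosang_le1 x : x != 0 -> -1 <= cosang c x <= 1.
Proof.
by move=> x0; rewrite -cosang_normalize; apply: edot_sphere_le1 => //; exact: on_sphere_normalize.
Qed.

Lemma gcone_near x : gcone c Rad x -> \forall y \near x, gcone c Rad y.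
Proof.
move=> /gconeP[x0 xc]; have cc := cosang_continuous (c := c) x0.
by apply: filterS2 (near_neq0 x0) (near_gt cc xc) => y y0 yc; apply/gconeP.
Qed.

Lemma C2_has_elap (h : 'rV[R]_n.+1 -> R) x : C2_on (gcone c Rad) h ->
  gcone c Rad x -> has_elap h x.
Proof.
move=> hC xC; split=> [|i]; last by have [_ _ /(_ i i)[]] := hC x xC.
by apply: filterS (gcone_near xC) => y /hC[_ dy _] i; have [] := dy i.
Qed.

(** A closed subset of the cube of side [-1, 1]. With a = cos Rad, taking b = 1 gives the closed
    ball, and b < 1 removes a neighbourhood of the centre. *)
Lemma compact_slab (a b : R) : compact [set p | on_sphere p /\ a <= edot p c <= b].
Proof.
have bd : compact [set v : 'rV[R]_n.+1 | forall i, v ord0 i \in `[(-1 : R), 1]].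
  apply: (@rV_compact _ _ (fun=> `[(-1 : R), 1]%classic)).
  by move=> _; apply: segment_compact.
apply: subclosed_compact bd _.
- have -> : [set p : 'rV[R]_n.+1 | on_sphere p /\ a <= edot p c <= b] =
    ((fun p => edot p p) @^-1` [set 1]) `&` ((fun p => edot p c) @^-1` `[a, b]).
    by apply/seteqP; split=> p /=; rewrite in_itv.
  apply: closedI; apply: preimage_closed; last exact: itv_closed.
  + by move=> p _; exact: edot2_continuous.
  + exact: closed_eq.
  + by move=> p _; exact: edot_continuous.
- move=> p [ps _] i; have : p ord0 i ^+ 2 <= 1.
    rewrite -ps /edot (bigD1 i)//= -expr2 lerDl sumr_ge0// => j _.
    by rewrite -expr2 sqr_ge0.
  by rewrite in_itv /=; nra.
Qed.

(** The squares of the n + 1 >= 2 coordinates of [c] sum to 1, so one of them is below 1. The part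
    of that basis vector orthogonal to [c] is then nonzero, and the point is sought in the plane
    that it spans with [c]. *)
Lemma sphere_point s : (0 < n)%N -> -1 <= s <= 1 ->
  exists2 p, on_sphere p & edot p c = s.
Proof.
move=> n0 s1.
have [i ci] : exists i, c ord0 i ^+ 2 < 1.
  apply/not_existsP => H.
  have : \sum_(i < n.+1) (1 : R) <= edot c c.
    apply: ler_sum => i _; rewrite -expr2 leNgt; apply/negP; exact: H.
  rewrite [edot c c]cs sumr_const card_ord.
  by rewrite -[leRHS](mulr1n 1) ler_nat leqNgt ltnS n0.
pose e := ebasis R i - c ord0 i *: c.
have ec : edot e c = 0.
  by rewrite /e -scaleN1r !edotDl !edotZl edot_basis [edot c c]cs; ring.
have ee : edot e e = 1 - c ord0 i ^+ 2.
  rewrite {1}/e -scaleN1r !edotDl !edotZl (edotC c) ec edot_basis /e !mxE !eqxx /=; ring.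
clearbody e; have q0 : 0 < 1 - c ord0 i ^+ 2 by lra.
pose t := Num.sqrt ((1 - s ^+ 2) / (1 - c ord0 i ^+ 2)).
have t2 : t ^+ 2 = (1 - s ^+ 2) / (1 - c ord0 i ^+ 2).
  have s2 : 0 <= 1 - s ^+ 2 by nra.
  by rewrite sqr_sqrtr// divr_ge0// ltW.
exists (s *: c + t *: e); last first.
  by rewrite edotDl !edotZl ec [edot c c]cs; ring.
rewrite /on_sphere edotDl !edotZl !(edotC _ (_ + _)) !edotDl !edotZl ec ee.
rewrite (edotC c e) ec [edot c c]cs.
transitivity (s ^+ 2 + t ^+ 2 * (1 - c ord0 i ^+ 2)); first by ring.
by rewrite t2 divfK ?gt_eqF//; ring.
Qed.

Lemma LB_radial (w w1 : R -> R) (a : R) p : on_sphere p ->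
  (\forall s \near edot p c, is_derive (s : R) 1 w (w1 s)) ->
  is_derive (edot p c) 1 w1 a ->
  LB (fun p => w (edot p c)) p =
    (1 - edot p c ^+ 2) * a - n%:R * edot p c * w1 (edot p c).
Proof.
move=> ps wd w1d; rewrite /LB hext_radial (elap_radial cs ps wd w1d).
by congr (_ - _ * _ * _); rewrite -natr1 addrK.
Qed.

Lemma radial_reg (a b : R) (w w1 w2 : R -> R) : a < cos Rad -> 1 < b ->
  (forall s, a < s < b -> is_derive s 1 w (w1 s)) ->
  (forall s, a < s < b -> is_derive s 1 w1 (w2 s)) ->
  (forall s, a < s < b -> {for s, continuous w2}) ->
  classical_reg c Rad (fun p => w (edot p c)).
Proof.
move=> aR b1 wd w1d w2c; split; last first.
  apply: continuous_in_subspaceT => p; rewrite inE => /gcballP[ps pc].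
  apply: (@continuous_comp _ _ _ (fun p => edot p c) w); first exact: edot_continuous.
  have /andP[_ p1] := edot_sphere_le1 ps cs.
  by apply: der_continuous (wd _ _); lra.
rewrite hext_radial => x /gconeP[x0 xc].
have /andP[_ x1] := cosang_le1 x0.
have xI : a < cosang c x < b by lra.
have cc := cosang_continuous (c := c) x0.
have wdn : \forall s \near cosang c x, is_derive (s : R) 1 w (w1 s).
  by apply: filterS (near_itvoo xI) => s; exact: wd.
have xn : \forall y \near x, y != 0 /\ a < cosang c y < b.
  by apply: filterS2 (near_neq0 x0) (cc _ (near_itvoo xI)) => y.
have comp_c (g : R -> R) : {for cosang c x, continuous g} ->
    {for x, continuous (fun y => g (cosang c y))}.
  exact: (@continuous_comp _ _ _ (cosang c) g _ cc).
have coordn i : {for x, continuous (fun y : 'rV[R]_n.+1 => y ord0 i)}.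
  exact: coord_continuous.
have enx0 : enorm x != 0 by rewrite gt_eqF// enorm_gt0.
have invn : {for x, continuous (fun y : 'rV[R]_n.+1 => (enorm y)^-1)}.
  by apply: contV => //; exact: enorm_continuous.
have cstc (r : R) : {for x, continuous (fun _ : 'rV[R]_n.+1 => r)}.
  exact: cst_continuous.
have ratc i := contM (coordn i) invn.
have dcc i : {for x, continuous (dcosang c i)}.
  exact: (contM (contB (cstc _) (contM cc (ratc i))) invn).
have ddcc i j : {for x, continuous (ddcosang c i j)}.
  have inv2 : {for x, continuous (fun y : 'rV[R]_n.+1 => (enorm y ^+ 2)^-1)}.
    apply: near_continuous (contM invn invn); apply: near_all => y.
    by rewrite expr2 invfM.
  have inv3 : {for x, continuous (fun y : 'rV[R]_n.+1 => (enorm y ^+ 3)^-1)}.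
    apply: near_continuous (contM invn (contM invn invn)); apply: near_all => y.
    by rewrite !exprS expr0 mulr1 !invfM.
  exact: (contB (contM (contN (contD (contM (dcc j) (ratc i))
    (contM (contM cc (contB (cstc _) (contM (contM (coordn i) (coordn j)) inv2))) invn))) invn)
    (contM (contM (contB (cstc _) (contM cc (ratc i))) (coordn j)) inv3)).
split.
- by apply: comp_c; exact: der_continuous (wd _ xI).
- move=> i; split.
    by have [] := is_derive_radial i x0 (wd _ xI).
  apply: (@near_continuous _ _ _ (fun y => w1 (cosang c y) * dcosang c i y)).
    apply: filterS xn => y [y0 yI]; rewrite /partial.
    by rewrite (derive_val (is_derive := is_derive_radial i y0 (wd _ yI))).
  by apply: contM (dcc i); apply: comp_c; exact: der_continuous (w1d _ xI).
- move=> i j; split.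
    by have [] := partial2_radial i j x0 wdn (w1d _ xI).
  apply: (@near_continuous _ _ _ (fun y => w2 (cosang c y) * dcosang c j y * dcosang c i y
                                + w1 (cosang c y) * ddcosang c i j y)).
    apply: filterS xn => y [y0 yI]; rewrite /partial -/(partial i _).
    have wdy : \forall s \near cosang c y, is_derive (s : R) 1 w (w1 s).
      by apply: filterS (near_itvoo yI) => s; exact: wd.
    by rewrite (derive_val (is_derive := partial2_radial i j y0 wdy (w1d _ yI))).
  apply: contD; apply: contM => //; [apply: contM => //|]; apply: comp_c.
    exact: w2c.
  exact: der_continuous (w1d _ xI).
Qed.

End Ball.

(** * Comparison with a singular solution *)

Lemma at_left_ex {R : realType} (a : R) (P : R -> Prop) :
  (\forall s \near a^'-, P s) -> exists2 d, d < a & forall s, d < s < a -> P s.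
Proof.
rewrite near_withinE => /nbhs_ballP[e /= e0 eP]; exists (a - e); first by lra.
by move=> s se; apply: eP; [rewrite /ball /= ltr_norml|]; lra.
Qed.

Lemma lt1_between {R : realType} (x y : R) : x < 1 -> y < 1 ->
  exists b, [/\ x < b, y < b & b < 1].
Proof.
move=> x1 y1; have [xy|yx] := leP x y; first by exists ((y + 1) / 2); split; lra.
by exists ((x + 1) / 2); split; lra.
Qed.

(** The arithmetic at the maximum M of (ws - v) / ph. Here F = f(ws), Fv = f(v), F1 = f'(ws), p =
    ph, l is the Laplacian of v, and A - B, C - D are those of ws and ph. The conditions give M (L
    F1 p + F) <= L (F - Fv) + (L - lam) Fv. Convexity bounds L (F - Fv) by L F1 M p, which cancels,
    leaving M F <= (L - lam) Fv. *)
Lemma maximum_bound {R : realType} (L lam M M0 F F1 Fv l p A B C D : R) :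
  0 <= M0 -> 0 < L -> L - lam <= M0 -> 0 < F -> 0 < Fv -> Fv <= F ->
  F - Fv <= F1 * (M * p) -> lam * Fv <= - l -> B - A = L * F ->
  L * F1 * p + F <= D - C -> 0 < M -> A - B - 1 * l - M * (C - D) <= 0 -> M <= M0.
Proof.
move=> M00 L0 LM F0 Fv0 FvF H1 H2 H3 H4 M0' H5; rewrite leNgt; apply/negP => MM.
have H4' : M * (L * F1 * p + F) <= M * (D - C) by rewrite ler_pM2l.
have H1' : L * (F - Fv) <= L * (F1 * (M * p)) by rewrite ler_pM2l.
have key : M * F <= (L - lam) * Fv by lra.
have : (L - lam) * Fv <= M0 * Fv by rewrite ler_pM2r.
have : M0 * Fv <= M0 * F by rewrite ler_wpM2l.
have : M0 * F < M * F by rewrite ltr_pM2r.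
lra.
Qed.

Section Extremal.
Context {R : realType} {n : nat} (c : 'rV[R]_n.+1) (Rad L : R).
Context (f f1 ws ws1 ws2 ph ph1 ph2 : R -> R).
Implicit Types (s lam A : R) (p : 'rV[R]_n.+1).
Hypothesis n3 : (3 <= n)%N.
Hypothesis cs : on_sphere c.
Hypothesis Rad0 : 0 < Rad.
Hypothesis Rad2 : Rad < pi / 2.
Hypothesis L0 : 0 < L.
Hypothesis fd : forall a : R, 0 <= a -> is_derive a 1 f (f1 a).
Hypothesis f1c : forall a : R, 0 <= a -> {for a, continuous f1}.
Hypothesis fm : forall a b : R, 0 <= a -> a <= b -> f a <= f b.
Hypothesis f0 : 0 < f 0.
Hypothesis fconv : forall a b : R, 0 <= a -> 0 <= b -> f a - f b <= f1 a * (a - b).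
Hypothesis wsd : forall s, 0 < s < 1 -> is_derive s 1 ws (ws1 s).
Hypothesis ws1d : forall s, 0 < s < 1 -> is_derive s 1 ws1 (ws2 s).
Hypothesis ws_eq : forall s, cos Rad < s < 1 ->
  n%:R * s * ws1 s - (1 - s ^+ 2) * ws2 s = L * f (ws s).
Hypothesis ws_Rad : ws (cos Rad) = 0.
Hypothesis ws_ge0 : forall s, cos Rad < s < 1 -> 0 <= ws s.
Hypothesis phd : forall s, 0 < s < 1 -> is_derive s 1 ph (ph1 s).
Hypothesis ph1d : forall s, 0 < s < 1 -> is_derive s 1 ph1 (ph2 s).
Hypothesis ph_gt0 : forall s, cos Rad <= s < 1 -> 0 < ph s.
Hypothesis ph_ge : forall s, cos Rad < s < 1 ->
  L * f1 (ws s) * ph s + f (ws s) <= n%:R * s * ph1 s - (1 - s ^+ 2) * ph2 s.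
Hypothesis ws_ph : forall e : R, 0 < e -> \forall s \near 1^'-, ws s <= e * ph s.
Hypothesis ws_oo : forall A, \forall s \near 1^'-, A < ws s.
Hypothesis supersol : forall lam, 0 < lam < L -> exists V V1 V2 : R -> R, exists2 b : R,
  1 < b & [/\ forall s, 0 < s < b -> is_derive s 1 V (V1 s),
    forall s, 0 < s < b -> is_derive s 1 V1 (V2 s) /\ {for s, continuous V2},
    forall s, cos Rad <= s <= 1 -> 0 <= V s,
    forall s, cos Rad < s <= 1 -> lam * f (V s) <= n%:R * s * V1 s - (1 - s ^+ 2) * V2 s
  & forall s, cos Rad < s < 1 -> V s <= ws s].

Let x01 : 0 < cos Rad < 1. Proof. exact: cos_Rad. Qed.

Let fpos (a : R) : 0 <= a -> 0 < f a.
Proof. by move=> a0; apply: lt_le_trans f0 _; exact: fm. Qed.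

Let edot_lt1 p : on_sphere p -> p != c -> edot p c < 1.
Proof.
move=> ps pc; have /andP[_] := edot_sphere_le1 ps cs.
rewrite le_eqVlt => /predU1P[/(edot_sphere_eq1 ps cs) /eqP|//].
by rewrite (negbTE pc).
Qed.

(* At a maximum of (ws - v) / ph the second-order condition, convexity of f and
   the strict Hardy-type inequality for ph bound the maximum by L - lam. *)
Lemma singular_comparison lam v (M0 : R) : 0 < lam -> 0 <= M0 -> L - lam <= M0 ->
  classical_supersol c Rad f lam v ->
  forall p, gball c Rad p -> p != c ->
    ws (edot p c) - v p <= M0 * ph (edot p c).
Proof.
move=> lam0 M00 LM [[vC2 vc] vsup v0] p0 /(gballP cs Rad0 Rad2)[p0s p0x] p0c.
have x01' := x01; have p01 := edot_lt1 p0s p0c.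
pose Q p := (ws (edot p c) - v p) / ph (edot p c).
have php0 : 0 < ph (edot p0 c) by apply: ph_gt0; lra.
rewrite -ler_pdivrMr// leNgt; apply/negP; rewrite -/(Q p0) => M0Q.
have Q0 : 0 < Q p0 by exact: le_lt_trans M00 M0Q.
(* Beyond [d] the quotient is at most half of its value at [p0], since v >= 0. The maximum over the
   slab therefore lies before [d], away from the inner edge [b]. *)
have [d d1 dP] := at_left_ex (ws_ph (divr_gt0 Q0 (ltr0Sn R 1))).
have [b [p0b db b1]] := lt1_between p01 d1.
pose K := [set p | on_sphere p /\ cos Rad <= edot p c <= b].
have Kc : compact K by exact: compact_slab.
have K0 : K p0 by split=> //; lra.
have KB p : K p -> gcball c Rad p.
  by move=> [ps /andP[pR _]]; apply/(gcballP cs Rad0 Rad2).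
have radc (w w1 : R -> R) : (forall s, 0 < s < 1 -> is_derive s 1 w (w1 s)) ->
    {within K, continuous (fun p => w (edot p c))}.
  move=> wd; apply: continuous_in_subspaceT => p; rewrite inE => -[ps pb].
  apply: (@continuous_comp _ _ _ (fun p => edot p c) w); first exact: edot_continuous.
  by apply: der_continuous (wd _ _); lra.
have Qc : {within K, continuous Q}.
  have c1 := radc _ _ wsd.
  have c2 : {within K, continuous v} by apply: continuous_subspaceW vc => p /KB.
  have c3 : {within K, continuous (fun p => (ph (edot p c))^-1)}.
    apply: continuous_in_subspaceT => p; rewrite inE => -[ps pb].
    apply: (@contV _ _ (fun p => ph (edot p c))).
      by rewrite gt_eqF// ph_gt0//; lra.
    apply: (@continuous_comp _ _ _ (fun p => edot p c) ph); first exact: edot_continuous.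
    by apply: der_continuous (phd _); lra.
  by move=> p; exact: (@contM _ (subspace K) _ _ p (@contB _ (subspace K) _ _ p (c1 p) (c2 p)) (c3 p)).
have [p1] := compact_EVT_max (ex_intro _ p0 K0) Kc Qc.
rewrite inE => -[p1s p1b] p1max.
have [s sE] : {s | edot p1 c = s} by exists (edot p1 c).
rewrite sE in p1b.
have Qp1 : Q p0 <= Q p1 by apply: p1max; rewrite inE.
have phs : 0 < ph s by apply: ph_gt0; lra.
have [M1 M1E] : {M | Q p1 = M} by exists (Q p1).
rewrite M1E in Qp1.
have vE : ws s - v p1 = M1 * ph s by rewrite -M1E /Q sE divfK// gt_eqF.
have vp1 : 0 <= v p1 by apply: v0; apply: KB; split=> //; rewrite sE.
have M1pos : 0 < M1 by lra.
have M1ph : 0 < M1 * ph s by rewrite mulr_gt0.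
(* On the boundary ws = 0 <= v, so the quotient cannot be positive there. *)
have sx0 : cos Rad < s.
  rewrite lt_neqAle; have /andP[-> _] := p1b; rewrite andbT; apply/eqP => E.
  have ws0 : ws s = 0 by rewrite -E ws_Rad.
  lra.
have sd : s <= d.
  rewrite leNgt; apply/negP => ds.
  have : ws s <= Q p0 / 2 * ph s by apply: dP; lra.
  have : Q p0 * ph s <= M1 * ph s by rewrite ler_pM2r.
  have : 0 < Q p0 * ph s by rewrite mulr_gt0.
  by move: vE; lra.
have p1B : gball c Rad p1 by apply/(gballP cs Rad0 Rad2); rewrite sE.
have p1n : p1 != 0 by exact: on_sphere_neq0.
have sI : 0 < s < 1 by lra.
have sI' : cos Rad < s < 1 by lra.
(* Instead of the quotient, the difference at the maximal level [M1] is differentiated: it vanishes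
   at [p1] and is nonpositive nearby. Being homogeneous of degree 0, it has an ambient local maximum
   there and not only one along the sphere. *)
pose h y := (ws (cosang c y) - 1 * hext v y) - M1 * ph (cosang c y).
have cE : cosang c p1 = s by rewrite cosang_sphere.
have near_d (w w1 : R -> R) : (forall s, 0 < s < 1 -> is_derive s 1 w (w1 s)) ->
    \forall s \near cosang c p1, is_derive (s : R) 1 w (w1 s).
  by move=> wd; rewrite cE; apply: filterS (near_itvoo sI) => t; exact: wd.
have near_d' (w w1 : R -> R) : (forall s, 0 < s < 1 -> is_derive s 1 w (w1 s)) ->
    \forall s \near edot p1 c, is_derive (s : R) 1 w (w1 s).
  by move=> wd; rewrite sE; apply: filterS (near_itvoo sI) => t; exact: wd.
have E1 : has_elap (fun y => ws (cosang c y)) p1.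
  by apply: (has_elap_radial p1n (near_d _ _ wsd)); rewrite cE; exact: ws1d.
have E2 : has_elap (hext v) p1 by apply: (C2_has_elap cs Rad0 Rad2 vC2); exact: gball_gcone.
have E3 : has_elap (fun y => ph (cosang c y)) p1.
  by apply: (has_elap_radial p1n (near_d _ _ phd)); rewrite cE; exact: ph1d.
have [E4 e4] := has_elapB 1 E1 E2.
have [E5 e5] := has_elapB M1 E4 E3.
have hmax : \forall y \near p1, h y <= h p1.
  have cc := cosang_continuous (c := c) p1n.
  have sb : cos Rad < cosang c p1 < b by rewrite cE sx0 (le_lt_trans sd).
  apply: filterS2 (near_neq0 p1n) (cc _ (near_itvoo sb)) => y y0 yb.
  have -> : h p1 = 0 by rewrite /h cE hext_sphere// mul1r vE subrr.
  have ys := on_sphere_normalize y0.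
  have yK : (enorm y)^-1 *: y \in K.
    by rewrite inE; split=> //; rewrite cosang_normalize; case/andP: yb => /ltW -> /ltW.
  move: (p1max _ yK); rewrite M1E /Q cosang_normalize ler_pdivrMr; last first.
    by apply: ph_gt0; case/andP: yb => /ltW -> yb; exact: lt_trans yb b1.
  by rewrite /h /hext mul1r subr_le0.
have := elap_max E5 hmax; rewrite e5 e4.
have dws : is_derive (edot p1 c) 1 ws1 (ws2 s) by rewrite sE; exact: ws1d.
have dph : is_derive (edot p1 c) 1 ph1 (ph2 s) by rewrite sE; exact: ph1d.
rewrite (elap_radial cs p1s (near_d' _ _ wsd) dws).
rewrite (elap_radial cs p1s (near_d' _ _ phd) dph) sE -/(LB v p1).
have -> : n.+1%:R - 1 = n%:R :> R by rewrite -natr1 addrK.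
have fvws : f (v p1) <= f (ws s).
  by apply: fm => //; rewrite -subr_ge0 vE ltW.
have fc := fconv (ws_ge0 sI') vp1; rewrite vE in fc.
move=> H; have := maximum_bound M00 L0 LM (fpos (ws_ge0 sI')) (fpos vp1) fvws fc
  (vsup _ p1B) (ws_eq sI') (ph_ge sI') M1pos H.
by rewrite leNgt (lt_le_trans M0Q Qp1).
Qed.

Lemma supersol_of_sol lam u : 0 < lam -> classical_sol c Rad f lam u ->
  classical_supersol c Rad f lam u.
Proof.
move=> lam0 [ur ue u0 ub]; split=> // [p pB|p]; first by rewrite ue.
move=> /(gcballP cs Rad0 Rad2)[ps]; rewrite le_eqVlt => /predU1P[E|pR].
  by rewrite ub//; split=> //; apply/gdist_eq.
by apply/ltW/u0; apply/gballP.
Qed.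

Lemma gball_point s : cos Rad < s < 1 ->
  exists p, [/\ on_sphere p, edot p c = s, gball c Rad p & p != c].
Proof.
move=> s1; have x01' := x01; have n0 : (0 < n)%N by exact: leq_trans n3.
have [|p ps E] := @sphere_point _ _ c cs s n0; first lra.
exists p; split=> //; first by apply/gballP => //; rewrite E; split=> //; lra.
by apply/eqP => pc; move: E; rewrite pc [edot c c]cs; lra.
Qed.

Lemma no_solution lam u : L < lam -> ~ classical_sol c Rad f lam u.
Proof.
move=> Llam uS; have lam0 : 0 < lam by exact: lt_trans Llam.
have x01' := x01.
have usup := supersol_of_sol lam0 uS; have [[_ uc] _ _ _] := uS.
have Kc : compact (gcball c Rad).
  have -> : gcball c Rad = [set p | on_sphere p /\ cos Rad <= edot p c <= 1].
    apply/seteqP; split=> p.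
      move=> /(gcballP cs Rad0 Rad2)[ps pR]; split=> //; rewrite pR.
      by have /andP[] := edot_sphere_le1 ps cs.
    by move=> [ps /andP[pR _]]; apply/(gcballP cs Rad0 Rad2).
  exact: compact_slab.
have cB : gcball c Rad c.
  by apply/(gcballP cs Rad0 Rad2); split=> //; rewrite [edot c c]cs; lra.
have [pm _ pmax] := compact_EVT_max (ex_intro _ c cB) Kc uc.
have [d d1 dP] := at_left_ex (ws_oo (u pm)).
have /andP[_ R1] := x01; have [s [Rs ds s1]] := lt1_between R1 d1.
have sR : cos Rad < s < 1 by rewrite Rs.
have sd : d < s < 1 by rewrite ds.
have [p [ps E pB pc]] := gball_point sR.
have M0 : L - lam <= 0 by lra.
have := singular_comparison lam0 (lexx 0) M0 usup pB pc.
have := dP _ sd; rewrite E mul0r.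
have : u p <= u pm.
  by apply: pmax; rewrite inE; apply/(gcballP cs Rad0 Rad2); rewrite E; split=> //; lra.
lra.
Qed.

Lemma solution_ex lam : 0 < lam < L -> exists u, classical_sol c Rad f lam u.
Proof.
move=> lamL; have x01' := x01.
have [V [V1 [V2 [b b1 [Vd V1d V0 Vsup _]]]]] := supersol lamL.
have VcI : {within `[cos Rad, 1], continuous V}.
  by apply: within_itv_continuous => s ss; apply: der_continuous (Vd s _); lra.
have le1 : cos Rad <= 1 by lra.
have [m _ mP] := EVT_max le1 VcI.
have n2 : (2 <= n)%N by exact: leq_trans n3.
have lam0 : 0 < lam by case/andP: lamL.
have Vd' s : cos Rad <= s <= 1 -> is_derive s 1 V (V1 s) by move=> ss; apply: Vd; lra.
have V1d' s : cos Rad <= s <= 1 -> is_derive s 1 V1 (V2 s).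
  by move=> ss; apply: (V1d s _).1; lra.
have VB s : cos Rad <= s <= 1 -> V s <= V m by move=> ss; apply: mP; rewrite in_itv.
have Vsup' s : cos Rad < s < 1 ->
    lam * f (V s) <= n%:R * s * V1 s - (1 - s ^+ 2) * V2 s.
  by move=> ss; apply: Vsup; lra.
have [w [w1 [w2 [wd w1d wR wpos weq]]]] :=
  radial_solution n2 x01 lam0 fd f1c fm f0 Vd' V1d' V0 VB Vsup'.
exists (fun p => w (edot p c)).
have c2 : cos Rad / 2 < cos Rad by lra.
split.
- apply: (@radial_reg _ _ c Rad cs Rad0 Rad2 (cos Rad / 2) 2 w w1 w2) => //.
  + by rewrite ltr1n.
  + by move=> s /andP[ss _]; exact: wd.
  + by move=> s /andP[ss _]; exact: (w1d s ss).1.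
  + by move=> s /andP[ss _]; exact: (w1d s ss).2.
- move=> p /(gballP cs Rad0 Rad2)[ps pR].
  have /andP[_ p1] := edot_sphere_le1 ps cs.
  have pI : cos Rad / 2 < edot p c < 2 by lra.
  have nwd : \forall s \near edot p c, is_derive (s : R) 1 w (w1 s).
    by apply: filterS (near_itvoo pI) => s /andP[ss _]; exact: wd.
  have pI' : cos Rad / 2 < edot p c by case/andP: pI.
  rewrite (LB_radial cs ps nwd (w1d _ pI').1) -weq ?pR//.
  by rewrite opprB.
- move=> p /(gballP cs Rad0 Rad2)[ps pR].
  have /andP[_ p1] := edot_sphere_le1 ps cs.
  by have /andP[] : 0 < w (edot p c) <= V (edot p c) by apply: wpos; lra.
- by move=> p [ps /(gdist_eq cs Rad0 Rad2 ps) ->].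
Qed.

Lemma lamstar_eq : lamstar c Rad f = L.
Proof.
have half : 0 < L / 2 < L by have L0' := L0; lra.
rewrite /lamstar; set S := [set _ | _].
have SL : ubound S L.
  move=> lam [lam0 [u uS]]; rewrite leNgt; apply/negP => Ll.
  exact: no_solution Ll uS.
have SI lam : 0 < lam < L -> S lam.
  by move=> lamL; split; [case/andP: lamL|exact: solution_ex].
have S0 : S !=set0 by exists (L / 2); exact: SI.
apply/eqP; rewrite eq_le ge_sup//= leNgt; apply/negP => supL.
(* Makes the midpoint of [sup S] and [L] positive, so that it lies in [S] and contradicts the
   supremum. *)
have sup0 : L / 2 <= sup S by apply: ub_le_sup; [exists L|exact: SI].
have : (sup S + L) / 2 <= sup S by apply: ub_le_sup; [exists L|apply: SI; lra].
lra.
Qed.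

(** * Limit of the minimal solutions *)

Section Minimal.
Context (U : R -> 'rV[R]_n.+1 -> R).
Hypothesis Umin : forall lam, 0 < lam < L -> minimal_sol c Rad f lam (U lam).

Lemma minimal_le lam p : 0 < lam < L -> gball c Rad p -> p != c ->
  U lam p <= ws (edot p c).
Proof.
move=> lamL pB pc; have x01' := x01.
have [V [V1 [V2 [b b1 [Vd V1d V0 Vsup Vws]]]]] := supersol lamL.
have [ps pR] := (gballP cs Rad0 Rad2 p).1 pB.
have p1 := edot_lt1 ps pc.
have [_ Ule] := Umin lamL.
apply: le_trans (Vws (edot p c) _); last lra.
apply: (Ule (fun p => V (edot p c))) => //; split.
- apply: (@radial_reg _ _ c Rad cs Rad0 Rad2 0 b V V1 V2) => //; first by case/andP: x01'.
  + by move=> s ss; exact: (V1d s ss).1.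
  + by move=> s ss; exact: (V1d s ss).2.
- move=> q /(gballP cs Rad0 Rad2)[qs qR].
  have /andP[_ q1] := edot_sphere_le1 qs cs.
  have qI : 0 < edot q c < b by lra.
  have nVd : \forall s \near edot q c, is_derive (s : R) 1 V (V1 s).
    by apply: filterS (near_itvoo qI) => s; exact: Vd.
  by rewrite (LB_radial cs qs nVd (V1d _ qI).1) opprB Vsup// qR.
- move=> q /(gcballP cs Rad0 Rad2)[qs qR].
  by have /andP[_ q1] := edot_sphere_le1 qs cs; apply: V0; lra.
Qed.

Lemma minimal_ge lam p : 0 < lam < L -> gball c Rad p -> p != c ->
  ws (edot p c) - (L - lam) * ph (edot p c) <= U lam p.
Proof.
move=> lamL pB pc; have lam0 : 0 < lam by case/andP: lamL.
have [US _] := Umin lamL.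
have LM : 0 <= L - lam by case/andP: lamL => _; rewrite subr_ge0; exact: ltW.
have := singular_comparison lam0 LM (lexx _) (supersol_of_sol lam0 US) pB pc.
lra.
Qed.

Let near_L : \forall lam \near L^'-, 0 < lam < L.
Proof.
near=> lam; apply/andP; split; near: lam; [exact: nbhs_left_gt|exact: nbhs_left_lt].
Unshelve. all: by end_near. Qed.

Let lower_cvg s : ws s - (L - lam) * ph s @[lam --> L^'-] --> ws s.
Proof.
apply: cvg_at_left_filter.
have : {for L, continuous (fun lam => ws s - (L - lam) * ph s)}.
  apply: contB; first exact: (der_continuous (der_cst (ws s) L)).
  apply: contM; last exact: (der_continuous (der_cst (ph s) L)).
  exact: (der_continuous (derB (der_cst L L) (der_id L))).
by rewrite /prop_for /continuous_at subrr mul0r subr0.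
Qed.

Lemma minimal_cvg p : gball c Rad p -> p != c ->
  U lam p @[lam --> L^'-] --> ws (edot p c).
Proof.
move=> pB pc; apply: (@squeeze_cvgr _ _ _ _ (fun lam => ws (edot p c) - (L - lam) * ph (edot p c))
  (fun=> ws (edot p c))); [|exact: lower_cvg|exact: cvg_cst].
by apply: filterS near_L => lam lamL; rewrite minimal_ge ?minimal_le.
Qed.

(* U lam is superharmonic, so its value at the centre dominates its minimum over
   a small geodesic sphere. *)
Lemma minimal_center_ge lam s (A : R) : 0 < lam < L -> cos Rad < s < 1 ->
  (forall p, on_sphere p -> edot p c = s -> A < U lam p) -> A < U lam c.
Proof.
move=> lamL sI HA; have x01' := x01; have lam0 : 0 < lam by case/andP: lamL.
have [[[UC2 Uc] Ue U0 _] _] := Umin lamL.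
pose K := [set p | on_sphere p /\ s <= edot p c <= 1].
have Kc : compact K by exact: compact_slab.
have Kcc : K c by split=> //; rewrite [edot c c]cs; lra.
have KB p : K p -> gball c Rad p.
  by move=> [ps ss]; apply/(gballP cs Rad0 Rad2); split=> //; lra.
have UK : {within K, continuous (U lam)}.
  apply: continuous_subspaceW Uc => p /KB /(gballP cs Rad0 Rad2)[ps pR].
  by apply/(gcballP cs Rad0 Rad2); split=> //; exact: ltW.
have [q] := compact_EVT_min (ex_intro _ c Kcc) Kc UK.
rewrite inE => Kq qmin; have [qs qI] := Kq.
apply: (@lt_le_trans _ _ (U lam q)); last by apply: qmin; rewrite inE.
apply: HA => //; apply/eqP; rewrite eq_le; have /andP[-> _] := qI; rewrite andbT.
rewrite leNgt; apply/negP => sq.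
have qB := KB _ Kq; have qn : q != 0 by exact: on_sphere_neq0.
(* The minimum of U at [q] is treated as a maximum of 0 - U, whose Laplacian lam f(U) is positive: a
   contradiction. *)
have E1 : has_elap (fun y => (fun=> 0 : R) (cosang c y)) q.
  apply: (@has_elap_radial _ _ c (fun=> 0) (fun=> 0) 0 q qn).
  by apply: near_all => t; exact: der_cst.
have e1 : elap (fun y => (fun=> 0 : R) (cosang c y)) q = 0.
  have nz : \forall t \near edot q c, is_derive (t : R) 1 (fun=> 0 : R) 0.
    by apply: near_all => t; exact: (der_cst 0 t).
  by rewrite (@elap_radial _ _ c (fun=> 0) (fun=> 0) 0 q cs qs nz (der_cst 0 _)) !mulr0 subrr.
have E2 : has_elap (hext (U lam)) q.
  by apply: (C2_has_elap cs Rad0 Rad2 UC2); exact: gball_gcone.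
have [E3 e3] := has_elapB 1 E1 E2.
have hmax : \forall y \near q, 0 - 1 * hext (U lam) y <= 0 - 1 * hext (U lam) q.
  have cc := cosang_continuous (c := c) qn.
  have sb : s < cosang c q by rewrite cosang_sphere.
  apply: filterS2 (near_neq0 qn) (near_gt cc sb) => y y0 yb.
  rewrite !mul1r !sub0r lerN2 (hext_sphere _ qs); apply: qmin; rewrite inE.
  split; first exact: on_sphere_normalize.
  by rewrite cosang_normalize; have /andP[_ ->] := cosang_le1 cs y0; rewrite ltW.
have := elap_max E3 hmax; rewrite e3 e1 -/(LB (U lam) q).
rewrite mul1r sub0r (Ue _ qB) leNgt => /negP; apply.
exact: mulr_gt0 lam0 (fpos (ltW (U0 _ qB))).
Qed.

(** [minimal_ge] holds only off the centre. It is applied on one small geodesic sphere where ws > A;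
    its bound depends on s alone, hence is uniform on that sphere, and superharmonicity carries it
    to the centre. *)
Lemma minimal_center_cvg : U lam c @[lam --> L^'-] --> +oo.
Proof.
apply/cvgryPgt => A; have x01' := x01.
have [d d1 dP] := at_left_ex (ws_oo A).
have /andP[_ R1] := x01; have [s [Rs ds s1]] := lt1_between R1 d1.
have sR : cos Rad < s < 1 by rewrite Rs.
have sd : d < s < 1 by rewrite ds.
have As := dP _ sd.
have := @lower_cvg s; move/cvgr_gt => /(_ _ As) nA.
apply: filterS2 near_L nA => lam lamL lamA.
apply: (minimal_center_ge lamL sR) => p ps E.
apply: lt_le_trans lamA _; rewrite -E; apply: minimal_ge => //.
  by apply/(gballP cs Rad0 Rad2); rewrite E; split=> //; lra.
by apply/eqP => pc; move: E; rewrite pc [edot c c]cs; lra.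
Qed.

End Minimal.

Lemma extremal_profile : lamstar c Rad f = L /\
  forall U : R -> 'rV[R]_n.+1 -> R,
    (forall lam, 0 < lam < L -> minimal_sol c Rad f lam (U lam)) ->
    (U lam c @[lam --> L^'-] --> +oo) /\
    (forall p, gball c Rad p -> p != c -> U lam p @[lam --> L^'-] --> ws (edot p c)).
Proof.
split; first exact: lamstar_eq.
by move=> U Umin; split; [exact: minimal_center_cvg|exact: minimal_cvg].
Qed.

End Extremal.

(** * Explicit profiles and the Hardy weight *)

Section Instances.
Context {R : realType}.
Implicit Types (e s t y : R).

Lemma near1_small (r : R) : 0 < r -> \forall s \near (1 : R)^'-, 0 < 1 - s ^+ 2 < r.
Proof.
move=> r0; near=> s.
have s0 : 0 < s by near: s; exact: nbhs_left_gt.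
have s1 : s < 1 by near: s; exact: nbhs_left_lt.
have sr : 1 - r / 2 < s by near: s; apply: nbhs_left_gt; lra.
by apply/andP; split; nra.
Unshelve. all: by end_near. Qed.

Lemma powRN_mono (r x y : R) : 0 <= r -> 0 < x -> x <= y -> y `^ (- r) <= x `^ (- r).
Proof.
move=> r0 x0 xy; rewrite !powRN lef_pV2 ?posrE ?powR_gt0//; last exact: lt_le_trans xy.
by apply: ge0_ler_powR => //; rewrite nnegrE ltW//; exact: lt_le_trans xy.
Qed.

Lemma powR_inv_exp (r x : R) : 0 < r -> 0 < x -> (x `^ r^-1) `^ r = x.
Proof. by move=> r0 x0; rewrite -powRrM mulVf ?gt_eqF// powRr1// ltW. Qed.

Lemma near1_powRN_oo (k A : R) : 0 < k ->
  \forall s \near (1 : R)^'-, A < (1 - s ^+ 2) `^ (- k).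
Proof.
move=> k0; pose B := Num.max A 1; have B0 : 0 < B by rewrite lt_max ltr01 orbT.
have BV0 : 0 < B^-1 by rewrite invr_gt0.
have r0 : 0 < B^-1 `^ k^-1 by rewrite powR_gt0.
apply: filterS (near1_small r0) => s /andP[Q0 Qr].
have AB : A <= B by rewrite le_max lexx.
apply: le_lt_trans AB _; rewrite powRN -[ltLHS]invrK ltf_pV2 ?posrE ?powR_gt0//.
rewrite -[ltRHS](powR_inv_exp k0)//.
by apply: gt0_ltr_powR => //; rewrite nnegrE ltW.
Qed.

Lemma near1_powRN_le (k g e : R) : k < g -> 0 < e ->
  \forall s \near (1 : R)^'-, (1 - s ^+ 2) `^ (- k) <= e * (1 - s ^+ 2) `^ (- g).
Proof.
move=> kg e0; have gk : 0 < g - k by rewrite subr_gt0.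
apply: filterS2 (near1_powRN_oo e^-1 gk) (near1_small ltr01) => s H /andP[Q0 _].
have -> : - g = - (g - k) + - k by lra.
rewrite powRD; last by rewrite (gt_eqF Q0) implybT.
rewrite mulrA ler_peMl ?powR_ge0// -ler_pdivrMl// mulr1; exact: ltW.
Qed.

Lemma der_quad e s : is_derive s 1 (fun t => e - t ^+ 2) (- (2 * s)).
Proof.
apply: der_ext (derB (der_cst e s) (derX 2 (der_id s))) _ _ => //.
by rewrite expr1; ring.
Qed.

Lemma quad_neq0 e s : 0 < e - s ^+ 2 -> e - s ^+ 2 != 0.
Proof. by move=> P0; rewrite gt_eqF. Qed.

Lemma der_log k e s : 0 < e - s ^+ 2 ->
  is_derive s 1 (fun t => k - ln (e - t ^+ 2)) (2 * s / (e - s ^+ 2)).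
Proof.
move=> P0; have P00 := quad_neq0 P0.
apply: der_ext (derB (der_cst k s) (@der_comp _ (@ln R) (fun t => e - t ^+ 2) s _ _
  (is_derive1_ln P0) (der_quad e s))) _ _ => //.
by field.
Qed.

Lemma der_log1 e s : 0 < e - s ^+ 2 ->
  is_derive s 1 (fun t => 2 * t / (e - t ^+ 2))
    (2 / (e - s ^+ 2) + 4 * s ^+ 2 / (e - s ^+ 2) ^+ 2).
Proof.
move=> P0; have P00 := quad_neq0 P0.
apply: der_ext (derM (derZ 2 (der_id s))
  (@derV _ (fun t => e - t ^+ 2) _ _ P00 (der_quad e s))) _ _ => //.
by field.
Qed.

Lemma quadV_continuous e s : 0 < e - s ^+ 2 ->
  {for s, continuous (fun t => (e - t ^+ 2)^-1)}.
Proof.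
move=> P0; apply: (@contV _ _ (fun t : R => e - t ^+ 2)); first exact: quad_neq0.
exact: der_continuous (der_quad e s).
Qed.

Lemma log2_continuous e s (a b : R) : 0 < e - s ^+ 2 ->
  {for s, continuous (fun t => a / (e - t ^+ 2) + b * t ^+ 2 / (e - t ^+ 2) ^+ 2)}.
Proof.
move=> P0; have Vc := quadV_continuous P0.
have E : (fun t => a / (e - t ^+ 2) + b * t ^+ 2 / (e - t ^+ 2) ^+ 2) =
    (fun t => a * (e - t ^+ 2)^-1 + (b * t ^+ 2) * ((e - t ^+ 2)^-1 * (e - t ^+ 2)^-1)).
  by apply/funext => t; rewrite expr2 invfM.
rewrite E; apply: contD; first exact: contZ.
apply: contM; last exact: contM.
exact: der_continuous (derZ b (derX 2 (der_id s))).
Qed.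

Lemma powR_pred (a y : R) : 0 < y -> y `^ (a - 1) = y `^ a / y.
Proof.
by move=> y0; rewrite powRD ?(gt_eqF y0) ?implybT// powRN powRr1// ltW.
Qed.

Lemma der_pow e (a : R) s : 0 < e - s ^+ 2 ->
  is_derive s 1 (fun t => (e - t ^+ 2) `^ a)
    (- (2 * a * s) * ((e - s ^+ 2) `^ a / (e - s ^+ 2))).
Proof.
move=> P0; have P00 := quad_neq0 P0.
apply: der_ext (@der_comp _ (fun y => y `^ a) (fun t => e - t ^+ 2) s _ _
  (is_derive1_powR a P0) (der_quad e s)) _ _ => //.
by rewrite powR_pred//; field.
Qed.

Lemma der_pow1 e (a : R) s : 0 < e - s ^+ 2 ->
  is_derive s 1 (fun t => - (2 * a * t) * ((e - t ^+ 2) `^ a / (e - t ^+ 2)))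
    ((e - s ^+ 2) `^ a * (- (2 * a) / (e - s ^+ 2)
       + 4 * a * (a - 1) * s ^+ 2 / (e - s ^+ 2) ^+ 2)).
Proof.
move=> P0; have P00 := quad_neq0 P0.
apply: der_ext (derM (derN (derZ (2 * a) (der_id s))) (derM (der_pow a P0)
  (@derV _ (fun t => e - t ^+ 2) _ _ P00 (der_quad e s)))) _ _ => //.
by move: ((e - s ^+ 2) `^ a) => X; field.
Qed.

Lemma pow2_continuous e (a k : R) s : 0 < e - s ^+ 2 ->
  {for s, continuous (fun t => k * ((e - t ^+ 2) `^ a * (- (2 * a) / (e - t ^+ 2)
       + 4 * a * (a - 1) * t ^+ 2 / (e - t ^+ 2) ^+ 2)))}.
Proof.
move=> P0; apply: contZ; apply: contM; last exact: log2_continuous.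
exact: der_continuous (der_pow a P0).
Qed.

(** Computes - Lap of - ln P with P = sin^2 r + d, expanded in 1 / P. At d = 0 the coefficients give
    L = 2 (N - 2) and L K = 2 (N - 1), K being the constant subtracted in f. For d > 0 the last term
    is nonnegative and is dropped in the supersolution estimate. [pow_identity] has the same
    shape. *)
Lemma log_identity (N d s : R) : 0 < 1 + d - s ^+ 2 ->
  N * s * (2 * s / (1 + d - s ^+ 2)) - (1 - s ^+ 2) *
    (2 / (1 + d - s ^+ 2) + 4 * s ^+ 2 / (1 + d - s ^+ 2) ^+ 2) =
  - (2 * (N - 1)) + (2 * (N - 2) * (1 + d) - 2 * d) / (1 + d - s ^+ 2)
    + 4 * d * (1 + d) / (1 + d - s ^+ 2) ^+ 2.
Proof. by move=> P0; have P00 := quad_neq0 P0; field. Qed.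

Lemma pow_identity (N d k X s : R) : 0 < 1 + d - s ^+ 2 ->
  N * s * (- (2 * - k * s) * (X / (1 + d - s ^+ 2))) - (1 - s ^+ 2) *
    (X * (- (2 * - k) / (1 + d - s ^+ 2)
      + 4 * - k * (- k - 1) * s ^+ 2 / (1 + d - s ^+ 2) ^+ 2)) =
  X * (- (2 * k * (N - 1 - 2 * k))
    + (2 * k * (N - 2 * (k + 1)) * (1 + d) - k * (4 * k + 2) * d) / (1 + d - s ^+ 2)
    + 4 * k * (k + 1) * d * (1 + d) / (1 + d - s ^+ 2) ^+ 2).
Proof. by move=> P0; have P00 := quad_neq0 P0; field. Qed.

(** After multiplication by P the worst case is P = S + d, on the boundary. There the gain (L -
    lam)(1 - S K) is of order one, and the losses are of order d. The gain is positive because S K <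
    1, that is f(0) > 0. *)
Lemma supersol_bound (L lam S K c d P : R) : 0 < d -> 0 < P <= S + d -> 0 < S ->
  0 <= K -> 0 < lam < L -> d * (K * (L - lam) + lam / S + c) <= (L - lam) * (1 - S * K) ->
  lam * ((1 + d / S) / P - K) <= - (L * K) + (L * (1 + d) - c * d) / P.
Proof.
move=> d0 /andP[P0 PS] S0 K0 lamL H.
have P00 : P != 0 by rewrite gt_eqF.
have S00 : S != 0 by rewrite gt_eqF.
rewrite -subr_ge0.
have -> : - (L * K) + (L * (1 + d) - c * d) / P - lam * ((1 + d / S) / P - K) =
    (L - lam + d * (L - c - lam / S) - (L - lam) * K * P) / P by field; rewrite S00 P00.
rewrite divr_ge0 ?(ltW P0)// subr_ge0.
have LK : 0 <= (L - lam) * K by rewrite mulr_ge0//; lra.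
have : (L - lam) * K * P <= (L - lam) * K * (S + d) by rewrite ler_wpM2l.
have : 0 <= d * L by rewrite mulr_ge0 ?ltW//; lra.
lra.
Qed.

Lemma small_delta (Z W : R) : 0 <= Z -> 0 < W -> exists2 d : R, 0 < d < 1 & d * Z <= W.
Proof.
move=> Z0 W0; have D0 : 0 < Z + W + 1 by lra.
exists (W / (Z + W + 1)).
  by rewrite divr_gt0//= ltr_pdivrMr//; lra.
by rewrite mulrAC ler_pdivrMr// ler_pM2l//; lra.
Qed.

Definition hardy (A g s : R) := (1 - s ^+ 2) `^ (- g) * (s - A).

Definition hardy1 (A g s : R) :=
  - (2 * - g * s) * ((1 - s ^+ 2) `^ (- g) / (1 - s ^+ 2)) * (s - A) + (1 - s ^+ 2) `^ (- g).

Definition hardy2 (A g s : R) := (1 - s ^+ 2) `^ (- g) *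
  ((- (2 * - g) / (1 - s ^+ 2) + 4 * - g * (- g - 1) * s ^+ 2 / (1 - s ^+ 2) ^+ 2) * (s - A)
   + 2 * (- (2 * - g * s) / (1 - s ^+ 2))).

Lemma der_hardy A g s : 0 < 1 - s ^+ 2 -> is_derive s 1 (hardy A g) (hardy1 A g s).
Proof.
move=> Q0; apply: der_ext (derM (der_pow (- g) Q0) (derB (der_id s) (der_cst A s))) _ _ => //.
by rewrite /hardy1 subr0 mulr1.
Qed.

Lemma der_hardy1 A g s : 0 < 1 - s ^+ 2 -> is_derive s 1 (hardy1 A g) (hardy2 A g s).
Proof.
move=> Q0; have Q00 := quad_neq0 Q0.
apply: der_ext (derD (derM (der_pow1 (- g) Q0) (derB (der_id s) (der_cst A s)))
  (der_pow (- g) Q0)) _ _ => //.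
by rewrite /hardy2; move: ((1 - s ^+ 2) `^ (- g)) => X; field.
Qed.

(* Improved Hardy inequality: with g = (n - 2) / 4, the weight Q^(-g) carries the
   optimal Hardy constant (n - 2)^2 / 4 = 4 g^2, and the factor s - A absorbs the
   curvature term n (n - 2) / 4 = 2 g (2 g + 1). *)
Lemma hardy_ge (A g s l : R) : A = 1 - (2 * g * (2 * g + 1))^-1 -> 1 <= g -> s < 1 -> 0 < 1 - s ^+ 2 ->
  1 - s < (2 * g * (2 * g + 1))^-1 -> l <= 4 * g ^+ 2 ->
  l / (1 - s ^+ 2) * hardy A g s + (1 - s ^+ 2) `^ (- g) <=
  (4 * g + 2) * s * hardy1 A g s - (1 - s ^+ 2) * hardy2 A g s.
Proof.
move=> A_def g1 s1 Q0 sA lg; have Q00 := quad_neq0 Q0.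
have X0 : 0 < (1 - s ^+ 2) `^ (- g) by rewrite powR_gt0.
rewrite /hardy /hardy1 /hardy2; move: X0; set X := _ `^ _ => X0.
have gg : 2 <= 2 * g * (2 * g + 1) by nra.
have gg0 : 2 * g * (2 * g + 1) != 0 by rewrite gt_eqF//; lra.
(* With G = 2 g (2 g + 1), this choice of [A] turns the remainder left after the Hardy term and the
   extra Q^(-g) into (G - 2)(1 - s), which is nonnegative. *)
have AE : 2 * g * (2 * g + 1) * A = 2 * g * (2 * g + 1) - 1.
  by rewrite A_def mulrBr mulr1 divff.
have sA0 : 0 < s - A by rewrite A_def; lra.
rewrite -subr_ge0.
have -> : (4 * g + 2) * s * (- (2 * - g * s) * (X / (1 - s ^+ 2)) * (s - A) + X) -
    (1 - s ^+ 2) * (X * ((- (2 * - g) / (1 - s ^+ 2) +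
      4 * - g * (- g - 1) * s ^+ 2 / (1 - s ^+ 2) ^+ 2) * (s - A)
      + 2 * (- (2 * - g * s) / (1 - s ^+ 2)))) -
    (l / (1 - s ^+ 2) * (X * (s - A)) + X) =
    X * ((4 * g ^+ 2 - l) / (1 - s ^+ 2) * (s - A)
       + (2 * s - 1 - 2 * g * (2 * g + 1) * s + 2 * g * (2 * g + 1) * A)).
  by field.
apply: mulr_ge0; first exact: ltW.
apply: addr_ge0.
  by rewrite mulr_ge0 ?(ltW sA0)// divr_ge0 ?(ltW Q0)// subr_ge0.
rewrite AE; have : 0 <= (2 * g * (2 * g + 1) - 2) * (1 - s) by rewrite mulr_ge0; lra.
lra.
Qed.

Lemma hardy_gt0 A g s : A < s -> 0 < 1 - s ^+ 2 -> 0 < hardy A g s.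
Proof. by move=> sA Q0; rewrite mulr_gt0 ?powR_gt0// subr_gt0. Qed.

Lemma near1_hardy (A k g e : R) : A < 1 -> k < g -> 0 < e ->
  \forall s \near (1 : R)^'-, (1 - s ^+ 2) `^ (- k) <= e * hardy A g s.
Proof.
move=> A1 kg e0.
have e'0 : 0 < e * ((1 - A) / 2) by rewrite mulr_gt0// divr_gt0//; lra.
have sA : \forall s \near (1 : R)^'-, (A + 1) / 2 < s by apply: nbhs_left_gt; lra.
apply: filterS2 (near1_powRN_le kg e'0) sA => s H sA.
apply: (le_trans H); rewrite -mulrA ler_pM2l// mulrC ler_wpM2l ?powR_ge0//.
lra.
Qed.

Lemma tangent_le (f f1 : R -> R) :
  (forall y, 0 <= y -> is_derive y 1 f (f1 y)) ->
  (forall x y, 0 <= x -> x <= y -> f1 x <= f1 y) ->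
  forall a b : R, 0 <= a -> 0 <= b -> f a - f b <= f1 a * (a - b).
Proof.
move=> fd f1m a b a0 b0.
have mono x y : 0 <= x -> x <= y -> f1 x * (y - x) <= f y - f x <= f1 y * (y - x).
  move=> x0; rewrite le_eqVlt => /predU1P[->|xy]; first by rewrite !subrr !mulr0 lexx.
  have fd' z : z \in `]x, y[ -> is_derive z 1 f (f1 z).
    by rewrite in_itv /= => zz; apply: fd; lra.
  have fc : {within `[x, y], continuous f}.
    by apply: within_itv_continuous => z zz; apply: der_continuous (fd z _); lra.
  have [z] := MVT xy fd' fc; rewrite in_itv /= => /andP[xz zy] ->.
  have xy0 : 0 < y - x by lra.
  by rewrite !ler_pM2r// !f1m//; lra.
have [ab|/ltW ba] := leP a b.
  by have /andP[H _] := mono a b a0 ab; lra.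
by have /andP[_ H] := mono b a b0 ba.
Qed.

Lemma sin_lt_asin (Rad q : R) : 0 < Rad -> Rad < pi / 2 -> 0 <= q <= 1 ->
  Rad < asin (Num.sqrt q) -> 1 - cos Rad ^+ 2 < q.
Proof.
move=> Rad0 Rad2 /andP[q0 q1] H.
have sq1 : Num.sqrt q <= 1 by rewrite -sqrtr1 ler_wsqrtr.
have sq0 : 0 <= Num.sqrt q by exact: sqrtr_ge0.
have sqI : Num.sqrt q \in `[-1, 1] by rewrite in_itv /=; lra.
have asI : -1 <= Num.sqrt q <= 1 by lra.
have p0 : 0 < pi :> R by exact: pi_gt0.
have : sin Rad < sin (asin (Num.sqrt q)).
  rewrite ltr_sin// in_itv /=; first lra.
  by rewrite asin_geNpi2// asin_lepi2.
rewrite asinK// => s1.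
have s0 : 0 < sin Rad by apply: sin_gt0_pihalf; lra.
rewrite -sin2cos2 -(sqr_sqrtr q0) ltr_pXn2r// nnegrE//; exact: ltW.
Qed.

Lemma R0_bound n (Rad : R) : (3 <= n)%N -> 0 < Rad -> Rad < pi / 2 -> Rad < R0 R n ->
  n%:R * (n%:R - 2) * (1 - cos Rad) < 2.
Proof.
move=> n3 Rad0 Rad2; have p0 : 0 < pi :> R by exact: pi_gt0.
rewrite /R0; set E := [set s | _] => H.
(* The supremum of the empty set is 0 by convention, which 0 < Rad < R0 excludes. *)
have E0 : E !=set0.
  apply/set0P/eqP => E0; move: H; rewrite E0 sup0; lra.
have [s [/andP[s0 s2] sE] Rs] := sup_gt E0 H.
have cI : cos s < cos Rad by rewrite ltr_cos// in_itv /=; lra.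
have c1 : cos Rad < 1 by rewrite -cos0 ltr_cos// in_itv /=; lra.
have cs1 : 0 < 1 - cos s by lra.
(* The quotient sin^2 s / (1 - cos s)^2 is (1 + cos s) / (1 - cos s), and its numerator is below
   2. *)
move: sE; rewrite sin2cos2 ltr_pdivlMr ?exprn_gt0//.
have -> : 1 - cos s ^+ 2 = (1 + cos s) * (1 - cos s) by ring.
rewrite expr2 mulrA ltr_pM2r// => H1.
have n3' : 3 <= n%:R :> R by rewrite ler_nat.
have : n%:R * (n%:R - 2) * (1 - cos Rad) <= n%:R * (n%:R - 2) * (1 - cos s).
  by rewrite ler_wpM2l ?mulr_ge0//; lra.
lra.
Qed.

End Instances.

(** * The power nonlinearity *)

(* The power-type data with k = 1 / (m - 1) and a = S^(-k); the nonlinearity is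
   y (y^(m-1) - K) with y = u + a, and y = Q^(-k) along the singular solution. *)
Lemma powm_inv {R : realType} (m k x : R) : k * (m - 1) = 1 -> 0 < x ->
  (x `^ (- k)) `^ (m - 1) = x^-1.
Proof. by move=> km x0; rewrite -powRrM mulNr km powR_inv1// ltW. Qed.

Lemma der_shift_pow {R : realType} (a b y : R) : 0 < y + a ->
  is_derive y 1 (fun y => (y + a) `^ b) (b * ((y + a) `^ b / (y + a))).
Proof.
move=> ya; have dadd : is_derive y 1 (fun y => y + a) 1.
  by apply: der_ext (derD (der_id y) (der_cst a y)) _ _ => //; rewrite addr0.
apply: der_ext (@der_comp _ (fun y => y `^ b) (fun y => y + a) y _ _
  (is_derive1_powR b ya) dadd) _ _ => //.
by rewrite mulr1 powR_pred.
Qed.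

Lemma der_pow_source {R : realType} (m K a y : R) : 0 < y + a ->
  is_derive y 1 (fun y => (y + a) * ((y + a) `^ (m - 1) - K)) (m * (y + a) `^ (m - 1) - K).
Proof.
move=> ya; have ya0 : y + a != 0 by rewrite gt_eqF.
have dadd : is_derive y 1 (fun y => y + a) 1.
  by apply: der_ext (derD (der_id y) (der_cst a y)) _ _ => //; rewrite addr0.
apply: der_ext (derM dadd (derB (der_shift_pow (m - 1) ya) (der_cst K y))) _ _.
  by move=> z.
by move: ((y + a) `^ (m - 1)) => X; field.
Qed.

Lemma pow_supersol {R : realType} (x0 N S k m K L lam : R) :
  0 < x0 < 1 -> S = 1 - x0 ^+ 2 -> 0 < k -> k * (m - 1) = 1 -> 0 < K -> S * K < 1 ->
  L = 2 * k * (N - 2 * (k + 1)) -> L * K = 2 * k * (N - 1 - 2 * k) -> 0 < lam < L ->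
  let a := S `^ (- k) in
  exists V V1 V2 : R -> R, exists2 b : R,
  1 < b & [/\ forall s : R, 0 < s < b -> is_derive s 1 V (V1 s),
    forall s : R, 0 < s < b -> is_derive s 1 V1 (V2 s) /\ {for s, continuous V2},
    forall s : R, x0 <= s <= 1 -> 0 <= V s,
    forall s : R, x0 < s <= 1 -> lam * ((V s + a) * ((V s + a) `^ (m - 1) - K)) <=
      N * s * V1 s - (1 - s ^+ 2) * V2 s
  & forall s : R, x0 < s < 1 -> V s <= (1 - s ^+ 2) `^ (- k) - a].
Proof.
move=> x01 SE k0 km K0 SK LE LK lamL a.
have S01 : 0 < S < 1 by rewrite SE; nra.
have Sp : 0 < S by lra.
have S00 : S != 0 by rewrite gt_eqF.
have lam0 : 0 < lam by lra.
have Z0 : 0 <= K * (L - lam) + lam / S + k * (4 * k + 2).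
  have H1 : 0 <= K * (L - lam) by rewrite mulr_ge0//; lra.
  have H2 : 0 <= lam / S by rewrite divr_ge0//; lra.
  have H3 : 0 <= k * (4 * k + 2) by rewrite mulr_ge0//; lra.
  lra.
have W0 : 0 < (L - lam) * (1 - S * K) by rewrite mulr_gt0//; lra.
have [d d01 dZ] := small_delta Z0 W0.
have d0 : 0 < d by lra.
(* For d < 1 the square of 1 + d/4 stays below 1 + d, so the regularized profile is smooth past the
   centre s = 1. *)
have Pb (s : R) : 0 < s < 1 + d / 4 -> 0 < 1 + d - s ^+ 2 by move=> sI; nra.
have PS (s : R) : x0 <= s <= 1 -> 0 < 1 + d - s ^+ 2 <= S + d.
  by move=> sI; rewrite SE; nra.
have Sd : 0 < S + d by lra.
(* The factor that makes [V] vanish on the boundary, where P = S + d; with it (V + a)^(m-1) = (S +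
   d) / (S P). *)
pose B := (S + d) `^ k * a.
have B0 : 0 < B by rewrite mulr_gt0// powR_gt0.
have BE : B `^ (m - 1) = (S + d) / S.
  by rewrite powRM ?powR_ge0// (powm_inv km)// -powRrM km powRr1// ltW.
exists (fun s => B * (1 + d - s ^+ 2) `^ (- k) - a),
  (fun s => B * (- (2 * - k * s) * ((1 + d - s ^+ 2) `^ (- k) / (1 + d - s ^+ 2)))),
  (fun s => B * ((1 + d - s ^+ 2) `^ (- k) * (- (2 * - k) / (1 + d - s ^+ 2)
     + 4 * - k * (- k - 1) * s ^+ 2 / (1 + d - s ^+ 2) ^+ 2))), (1 + d / 4); first lra.
split.
- move=> s sI; apply: der_ext (derB (derZ B (der_pow (- k) (Pb s sI))) (der_cst a s)) _ _.
    by move=> z.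
  exact: subr0.
- move=> s sI; split; first exact: derZ (der_pow1 (- k) (Pb s sI)).
  exact: pow2_continuous (Pb s sI).
- move=> s sI; have /andP[P0 PSd] := PS s sI.
  have H : (S + d) `^ (- k) <= (1 + d - s ^+ 2) `^ (- k).
    by apply: powRN_mono => //; exact: ltW.
  have -> : a = B * (S + d) `^ (- k).
    by rewrite /B mulrAC powRN divff ?mul1r// gt_eqF// powR_gt0.
  by rewrite subr_ge0 ler_pM2l.
- move=> s sI; have sI' : x0 <= s <= 1 by lra.
  have PI := PS s sI'; have P0 : 0 < 1 + d - s ^+ 2 by lra.
  have P00 := quad_neq0 P0.
  have H := supersol_bound d0 PI Sp (ltW K0) lamL dZ.
  rewrite subrK powRM ?powR_ge0 ?(ltW B0)// BE (powm_inv km)//.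
  have -> : (S + d) / S * (1 + d - s ^+ 2)^-1 = (1 + d / S) / (1 + d - s ^+ 2).
    by field; rewrite S00 P00.
  set X := _ `^ (- k); have X0 : 0 < X by rewrite powR_gt0.
  have -> : N * s * (B * (- (2 * - k * s) * (X / (1 + d - s ^+ 2)))) -
      (1 - s ^+ 2) * (B * (X * (- (2 * - k) / (1 + d - s ^+ 2) +
        4 * - k * (- k - 1) * s ^+ 2 / (1 + d - s ^+ 2) ^+ 2))) =
      B * (N * s * (- (2 * - k * s) * (X / (1 + d - s ^+ 2))) - (1 - s ^+ 2) *
        (X * (- (2 * - k) / (1 + d - s ^+ 2)
        + 4 * - k * (- k - 1) * s ^+ 2 / (1 + d - s ^+ 2) ^+ 2))).
    by ring.
  rewrite pow_identity// [leLHS]mulrCA [leRHS]mulrA (ler_pM2l (mulr_gt0 B0 X0)).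
  apply: (le_trans H); rewrite LK LE lerDl.
  by rewrite divr_ge0 ?sqr_ge0// !mulr_ge0//; lra.
- move=> s sI; have sI' : x0 <= s < 1 by lra.
  have Qp : 0 < 1 - s ^+ 2 by nra.
  have QS' : 1 - s ^+ 2 <= S by rewrite SE; nra.
  have P0 : 0 < 1 + d - s ^+ 2 by lra.
  rewrite lerD2r /B /a !powRN mulrAC -mulrA -invfM.
  rewrite ler_pdivrMr ?mulr_gt0 ?powR_gt0// mulrC ler_pdivlMr ?powR_gt0//.
  rewrite -!powRM ?(ltW P0) ?(ltW Sp) ?(ltW Sd) ?(ltW Qp)//.
  apply: ge0_ler_powR; rewrite ?nnegrE ?mulr_ge0 ?(ltW k0) ?(ltW P0) ?(ltW Sp) ?(ltW Sd) ?(ltW Qp)//.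
  (* With Q = 1 - s^2, the comparison V <= ws amounts to (S + d) Q <= S (Q + d), that is Q <= S. *)
  have : d * (1 - s ^+ 2) <= d * S by rewrite ler_pM2l.
  lra.
Qed.

Lemma pow_core {R : realType} {n : nat} (c : 'rV[R]_n.+1) (Rad m k K L S g A : R) :
  (3 <= n)%N -> on_sphere c -> 0 < Rad -> Rad < pi / 2 ->
  S = 1 - cos Rad ^+ 2 -> n%:R = 4 * g + 2 -> 1 <= g -> A < cos Rad ->
  (forall s, cos Rad <= s -> 1 - s < (2 * g * (2 * g + 1))^-1) ->
  A = 1 - (2 * g * (2 * g + 1))^-1 ->
  1 < m -> 0 < k -> k * (m - 1) = 1 -> k + 1 <= g -> 0 < K -> S * K < 1 -> 0 < L ->
  L = 2 * k * (n%:R - 2 * (k + 1)) -> L * K = 2 * k * (n%:R - 1 - 2 * k) ->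
  L * m <= 4 * g ^+ 2 ->
  let a := S `^ (- k) in let f := fun y : R => (y + a) * ((y + a) `^ (m - 1) - K) in
  lamstar c Rad f = L /\
  forall U : R -> 'rV[R]_n.+1 -> R,
    (forall lam, 0 < lam < L -> minimal_sol c Rad f lam (U lam)) ->
    (U lam c @[lam --> L^'-] --> +oo) /\
    (forall p, gball c Rad p -> p != c ->
       U lam p @[lam --> L^'-] --> (1 - edot p c ^+ 2) `^ (- k) - a).
Proof.
move=> n3 cs Rad0 Rad2 SE Ng g1 AR sg AE m1 k0 km kg1 K0 SK L0 LE LK lg a f.
have cR := cos_Rad Rad0 Rad2.
have sup (lam : R) (lamL : 0 < lam < L) := pow_supersol cR SE k0 km K0 SK LE LK lamL.
have S01 : 0 < S < 1 by rewrite SE; move: (cos Rad) cR => x xI; nra.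
have Sp : 0 < S by lra.
have QS s : cos Rad < s < 1 -> 0 < 1 - s ^+ 2 <= S.
  by rewrite SE; move: (cos Rad) cR => x xI sI; nra.
have Q0 (s : R) : 0 < s < 1 -> 0 < 1 - s ^+ 2 by move=> sI; nra.
have cR0 : 0 < cos Rad by case/andP: cR.
have s01 s : cos Rad < s < 1 -> 0 < s < 1.
  by move=> /andP[sR ->]; rewrite (lt_trans cR0 sR).
have a0 : 0 < a by rewrite powR_gt0.
have m10 : 0 <= m - 1 by rewrite subr_ge0 ltW.
have m0 : 0 < m by rewrite (lt_trans ltr01).
pose f1 (y : R) := m * (y + a) `^ (m - 1) - K.
have ya (y : R) : 0 <= y -> 0 < y + a by move=> y0; rewrite ltr_wpDl.
have fd (y : R) : 0 <= y -> is_derive y 1 f (f1 y).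
  by move=> y0; exact: der_pow_source (ya y y0).
have f1c (y : R) : 0 <= y -> {for y, continuous f1}.
  move=> y0; exact: der_continuous (derB (derZ m (der_shift_pow (m - 1) (ya y y0))) (der_cst K y)).
have f1m (x y : R) : 0 <= x -> x <= y -> f1 x <= f1 y.
  move=> x0 xy; rewrite /f1 lerD2r ler_pM2l//.
  apply: ge0_ler_powR => //; rewrite ?nnegrE ?lerD2r//; apply/ltW/ya => //.
  exact: le_trans xy.
have SKV : K < S^-1 by rewrite -[ltRHS]mul1r ltr_pdivlMr// mulrC.
have aV : a `^ (m - 1) = S^-1 by exact: powm_inv.
have f10 : 0 <= f1 0.
  rewrite /f1 add0r aV subr_ge0 ltW// (lt_trans SKV)// ltr_pMl ?invr_gt0//.
have fconv := tangent_le fd f1m.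
have fm (x y : R) : 0 <= x -> x <= y -> f x <= f y.
  move=> x0 xy; have y0 : 0 <= y by exact: le_trans xy.
  rewrite -subr_le0; apply: le_trans (fconv x y x0 y0) _.
  by rewrite mulr_ge0_le0 ?subr_le0//; exact: le_trans f10 (f1m _ _ (lexx 0) x0).
have f0 : 0 < f 0 by rewrite /f add0r aV mulr_gt0// subr_gt0.
pose ws (s : R) := (1 - s ^+ 2) `^ (- k) - a.
pose ws1 (s : R) := - (2 * - k * s) * ((1 - s ^+ 2) `^ (- k) / (1 - s ^+ 2)).
pose ws2 (s : R) := (1 - s ^+ 2) `^ (- k) * (- (2 * - k) / (1 - s ^+ 2)
       + 4 * - k * (- k - 1) * s ^+ 2 / (1 - s ^+ 2) ^+ 2).
have wsd (s : R) : 0 < s < 1 -> is_derive s 1 ws (ws1 s).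
  move=> sI; apply: der_ext (derB (der_pow (- k) (Q0 s sI)) (der_cst a s)) _ _.
    by move=> z.
  exact: subr0.
have ws1d (s : R) : 0 < s < 1 -> is_derive s 1 ws1 (ws2 s).
  by move=> sI; exact: der_pow1 (Q0 s sI).
have fws (s : R) : 0 < s < 1 ->
    f (ws s) = (1 - s ^+ 2) `^ (- k) * ((1 - s ^+ 2)^-1 - K).
  by move=> sI; rewrite /f /ws subrK (powm_inv km (Q0 s sI)).
have f1ws (s : R) : 0 < s < 1 -> f1 (ws s) = m / (1 - s ^+ 2) - K.
  by move=> sI; rewrite /f1 /ws subrK (powm_inv km (Q0 s sI)).
have weq (s : R) : cos Rad < s < 1 ->
    n%:R * s * ws1 s - (1 - s ^+ 2) * ws2 s = L * f (ws s).
  move=> sI; have Q0s := Q0 s (s01 s sI); have Q00 := quad_neq0 Q0s.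
  have := @pow_identity R n%:R 0 k ((1 - s ^+ 2) `^ (- k)) s; rewrite !addr0 => /(_ Q0s) H.
  rewrite (fws s (s01 s sI)) /ws1 /ws2 H [RHS]mulrCA [L * _]mulrBr LK LE.
  by congr (_ * _); field.
have wR : ws (cos Rad) = 0 by rewrite /ws -SE subrr.
have wge (s : R) : cos Rad < s < 1 -> 0 <= ws s.
  move=> sI; have /andP[Qp QS'] := QS s sI.
  by rewrite subr_ge0; apply: powRN_mono => //; exact: ltW.
have phd (s : R) : 0 < s < 1 -> is_derive s 1 (hardy A g) (hardy1 A g s).
  by move=> sI; exact: der_hardy (Q0 s sI).
have ph1d (s : R) : 0 < s < 1 -> is_derive s 1 (hardy1 A g) (hardy2 A g s).
  by move=> sI; exact: der_hardy1 (Q0 s sI).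
have phpos (s : R) : cos Rad <= s < 1 -> 0 < hardy A g s.
  move=> /andP[sR s1]; apply: hardy_gt0; first exact: lt_le_trans sR.
  by apply: Q0; rewrite s1 andbT; exact: lt_le_trans sR.
have phge (s : R) : cos Rad < s < 1 -> L * f1 (ws s) * hardy A g s + f (ws s) <=
    n%:R * s * hardy1 A g s - (1 - s ^+ 2) * hardy2 A g s.
  move=> sI; have Q0s := Q0 s (s01 s sI); have /andP[sR s1] := sI.
  have hp : 0 <= hardy A g s by apply/ltW/phpos; rewrite (ltW sR).
  have H := hardy_ge AE g1 s1 Q0s (sg s (ltW sR)) lg.
  rewrite Ng; apply: le_trans H; rewrite (fws s (s01 s sI)) (f1ws s (s01 s sI)).
  (* Since f'(ws) = m/Q - K, the terms with K have the favourable sign and are dropped. What remains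
     of f(ws) is Q^(-k-1), and it fits under the extra Q^(-g) of [hardy_ge] because k + 1 <= g and Q
     <= 1. *)
  have H1 : (1 - s ^+ 2) `^ (- k - 1) <= (1 - s ^+ 2) `^ (- g).
    apply: ger_powR; last by rewrite -opprD lerN2.
    by rewrite Q0s lerBlDr lerDl sqr_ge0.
  rewrite (powR_pred _ Q0s) in H1.
  have H2 : 0 <= (1 - s ^+ 2) `^ (- k) * K by rewrite mulr_ge0 ?powR_ge0 ?(ltW K0).
  have H3 : 0 <= L * K * hardy A g s by exact: mulr_ge0 (mulr_ge0 (ltW L0) (ltW K0)) hp.
  move: H1 H2 H3; move: (hardy A g s) ((1 - s ^+ 2) `^ (- k)) ((1 - s ^+ 2) `^ (- g)) => h X Y.
  move: ((1 - s ^+ 2)^-1) => q H1 H2 H3.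
  have -> : L * (m * q - K) * h + X * (q - K) =
    L * m * q * h - L * K * h + (X * q - X * K) by ring.
  by apply: lerD; [rewrite gerBl|apply: le_trans H1; rewrite gerBl].
have wsph (e : R) : 0 < e -> \forall s \near 1^'-, ws s <= e * hardy A g s.
  move=> e0; have kg : k < g by rewrite (lt_le_trans _ kg1)// ltrDl.
  have A1 : A < 1 by case/andP: cR => _; exact: lt_trans.
  apply: filterS (near1_hardy A1 kg e0) => s H.
  by apply: le_trans H; rewrite /ws gerBl ltW.
have wsoo (B : R) : \forall s \near 1^'-, B < ws s.
  by apply: filterS (near1_powRN_oo (B + a) k0) => s H; rewrite /ws ltrBrDr.
exact: (@extremal_profile R n c Rad L f f1 ws ws1 ws2 (hardy A g) (hardy1 A g) (hardy2 A g)
  n3 cs Rad0 Rad2 L0 fd f1c fm f0 fconv wsd ws1d weq wR wge phd ph1d phpos phge wsph wsoo sup).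
Qed.

(** With k = 1 / (m - 1) one has m / (m - 1) = k + 1 and L m = 2 (k + 1)(N - 2 (k + 1)). [Nm m] is
    the larger root in N of the equation L m = (N - 2)^2 / 4, the Hardy threshold. The bound on [K]
    is what converts the radius condition S < (N - 2) / N into S K < 1. *)
Lemma pow_params {R : realType} (m N : R) : 1 < m -> Nm m <= N ->
  let k := (m - 1)^-1 in let L := 2 / (m - 1) * (N - 2 * m / (m - 1)) in
  let K := ((m - 1) * N - (m + 1)) / ((m - 1) * N - 2 * m) in
  [/\ [/\ 0 < k, k * (m - 1) = 1, 6 <= N & k + 1 <= (N - 2) / 4],
      [/\ L = 2 * k * (N - 2 * (k + 1)), L * K = 2 * k * (N - 1 - 2 * k) & 0 < L],
      0 < K <= N / (N - 2) & L * m <= (N - 2) ^+ 2 / 4].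
Proof.
move=> m1 nm; have mm : 0 < m - 1 by lra.
have mm0 : m - 1 != 0 by rewrite gt_eqF.
move=> k L K; have k0 : 0 < k by rewrite invr_gt0.
have km : k * (m - 1) = 1 by rewrite mulVf.
have kd : k = (m - 1)^-1 by [].
have qE : m / (m - 1) = k + 1.
  by rewrite -{1}[m](subrK 1) mulrDl divff// mul1r addrC.
have LE : L = 2 * k * (N - 2 * (k + 1)).
  by rewrite /L -[2 * m / (m - 1)]mulrA qE -/k.
have KE : K = (N - 1 - 2 * k) / (N - 2 * (k + 1)).
  have -> : K = ((m - 1) * (N - 1 - 2 * k)) / ((m - 1) * (N - 2 * (k + 1))).
    by rewrite /K; congr (_ / _); rewrite kd; field.
  by rewrite -mulf_div divff// mul1r.
have {nm} : 2 + 4 * (k + 1) + 4 * Num.sqrt (k + 1) <= N.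
  by move: nm; rewrite /Nm -mulrA qE.
have : 1 <= Num.sqrt (k + 1) by rewrite -[leLHS]sqrtr1 ler_wsqrtr// lerDr ltW.
have : Num.sqrt (k + 1) ^+ 2 = k + 1 by rewrite sqr_sqrtr// addr_ge0// ltW.
move: (Num.sqrt _) => r r2 r1 Nk.
have mk : k * m = k + 1 by move: km; rewrite mulrBr mulr1; lra.
clearbody k L K; clear qE kd.
have Nk2 : 0 < N - 2 * (k + 1) by lra.
have N2 : 0 < N - 2 by lra.
have D0 : N - 2 * (k + 1) != 0 by rewrite gt_eqF.
have L0 : 0 < L by rewrite LE !mulr_gt0.
split=> //.
- by split=> //; lra.
- by split=> //; rewrite LE KE; field.
- rewrite KE divr_gt0//=; last lra.
  rewrite ler_pdivrMr// mulrAC ler_pdivlMr//.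
  rewrite -subr_ge0; have -> : N * (N - 2 * (k + 1)) - (N - 1 - 2 * k) * (N - 2) = N - 2 - 4 * k.
    by ring.
  lra.
- have -> : L * m = 2 * (k + 1) * (N - 2 * (k + 1)).
    by rewrite LE -mk; ring.
  rewrite ler_pdivlMr//.
  have : 0 <= (N - 2 - 4 * (k + 1) - 4 * r) * (N - 2 - 4 * (k + 1) + 4 * r).
    by rewrite mulr_ge0//; lra.
  have -> : (N - 2 - 4 * (k + 1) - 4 * r) * (N - 2 - 4 * (k + 1) + 4 * r) =
    (N - 2 - 4 * (k + 1)) ^+ 2 - 16 * r ^+ 2 by ring.
  rewrite r2 -subr_ge0 => H; rewrite -subr_ge0.
  have -> : (N - 2) ^+ 2 - 2 * (k + 1) * (N - 2 * (k + 1)) * 4 =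
    (N - 2 - 4 * (k + 1)) ^+ 2 - 16 * (k + 1) - 0 by ring.
  exact: H.
Qed.

(** * The two extremal solutions *)

Section ExtremalSolution.
Context {R : realType} (n : nat) (c : 'rV[R]_n.+1) (Rad : R).
Implicit Types s : R.
Hypothesis n3 : (3 <= n)%N.
Hypothesis cs : on_sphere c.
Hypothesis Rad0 : 0 < Rad.
Hypothesis Rad2 : Rad < pi / 2.
Hypothesis RadR0 : Rad < R0 R n.
Let N : R := n%:R.
Let S : R := 1 - cos Rad ^+ 2.
Let g : R := (N - 2) / 4.
Let A : R := 1 - (2 * g * (2 * g + 1))^-1.

Let sin2S : sin Rad ^+ 2 = S. Proof. exact: sin2cos2. Qed.

Let cR : 0 < cos Rad < 1. Proof. exact: cos_Rad. Qed.

Let S01 : 0 < S < 1.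
Proof. by have := cR; rewrite /S; move: (cos Rad) => x x01; nra. Qed.

Let QS s : cos Rad <= s < 1 -> 0 < 1 - s ^+ 2 <= S.
Proof. by have := cR; rewrite /S; move: (cos Rad) => x x01 sI; nra. Qed.

Let Q0 s : 0 < s < 1 -> 0 < 1 - s ^+ 2.
Proof. by move=> sI; nra. Qed.

(** Here the radius R0 enters: 2 g (2 g + 1) = N (N - 2) / 4, so the bound on 1 - cos Rad puts the
    zero [A] of the weight outside the closed ball. *)
Let N10 : 6 <= N -> [/\ 1 <= g, N = 4 * g + 2, A < cos Rad
  & forall s, cos Rad <= s -> 1 - s < (2 * g * (2 * g + 1))^-1].
Proof.
move=> N6; have gE : 2 * g * (2 * g + 1) = N * (N - 2) / 4 by rewrite /g; field.
have NN : 0 < N * (N - 2) by rewrite mulr_gt0//; lra.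
have H : 1 - cos Rad < (2 * g * (2 * g + 1))^-1.
  rewrite gE invf_div ltr_pdivlMr// mulrC.
  by have := R0_bound n3 Rad0 Rad2 RadR0; rewrite -/N; lra.
split; rewrite /A; [by rewrite /g; lra|by rewrite /g; lra|lra|].
by move=> s sR; lra.
Qed.

Lemma exp_extremal : (10 <= n)%N -> Rad < asin (Num.sqrt ((n%:R - 2) / (n%:R - 1))) ->
  let f := f_exp n Rad in let L := 2 * (n%:R - 2) in
  lamstar c Rad f = L /\
  forall U : R -> 'rV[R]_n.+1 -> R,
    (forall lam, 0 < lam < L -> minimal_sol c Rad f lam (U lam)) ->
    (U lam c @[lam --> L^'-] --> +oo) /\
    (forall p, gball c Rad p -> p != c ->
       U lam p @[lam --> L^'-] --> ln S - ln (1 - edot p c ^+ 2)).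
Proof.
move=> n10 RadE f L.
have N10' : 10 <= N by rewrite ler_nat.
have N6 : 6 <= N by lra.
have [g1 Ng AR sg] := N10 N6; have S01' := S01; have cR' := cR.
pose K := (N - 1) / (N - 2).
have K0 : 0 < K by rewrite divr_gt0//; lra.
have S00 : S != 0 by rewrite gt_eqF//; lra.
(* The condition on R_e reads S < (N - 2) / (N - 1) = 1 / K, which is f(0) > 0. *)
have SK : S * K < 1.
  have q01 : 0 <= (N - 2) / (N - 1) <= 1.
    by rewrite divr_ge0/= ?ler_pdivrMr//; lra.
  have := sin_lt_asin Rad0 Rad2 q01 RadE; rewrite -/S => SN.
  by rewrite /K mulrA ltr_pdivrMr; [move: SN; rewrite ltr_pdivlMr; lra|lra].
have fE y : f y = expR y / S - K by rewrite /f /f_exp sin2S.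
have L0 : 0 < L by rewrite /L -/N; lra.
have LE : L = 2 * (N - 2) by [].
have LK : L * K = 2 * (N - 1) by rewrite LE /K; field; rewrite gt_eqF//; lra.
pose f1 (y : R) := expR y / S.
have fd (y : R) : 0 <= y -> is_derive y 1 f (f1 y).
  move=> _; have d := derB (derM (is_derive_expR y) (der_cst S^-1 y)) (der_cst K y).
  by apply: der_ext d _ _ => [z|]; rewrite ?fE// /f1 mulr0 addr0 subr0.
have f1c (y : R) : 0 <= y -> {for y, continuous f1}.
  move=> _; exact: der_continuous (derM (is_derive_expR y) (der_cst S^-1 y)).
have f1m (a b : R) : 0 <= a -> a <= b -> f1 a <= f1 b.
  by move=> _ ab; rewrite /f1 ler_pM2r ?invr_gt0 ?ler_expR//; lra.
have fm (a b : R) : 0 <= a -> a <= b -> f a <= f b.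
  by move=> a0 ab; rewrite !fE lerD2r; exact: f1m.
have f0 : 0 < f 0.
  by rewrite fE expR0 subr_gt0 ltr_pdivlMr; lra.
have fconv := tangent_le fd f1m.
pose ws (s : R) := ln S - ln (1 - s ^+ 2).
pose ws1 (s : R) := 2 * s / (1 - s ^+ 2).
pose ws2 (s : R) := 2 / (1 - s ^+ 2) + 4 * s ^+ 2 / (1 - s ^+ 2) ^+ 2.
have exp_ws (a b : R) : 0 < a -> 0 < b -> expR (ln a - ln b) = a / b.
  by move=> a0 b0; rewrite expRD expRN !lnK.
have wsd (s : R) : 0 < s < 1 -> is_derive s 1 ws (ws1 s).
  by move=> sI; exact: der_log (Q0 sI).
have ws1d (s : R) : 0 < s < 1 -> is_derive s 1 ws1 (ws2 s).
  by move=> sI; exact: der_log1 (Q0 sI).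
have expws (s : R) : cos Rad < s < 1 -> f1 (ws s) = 1 / (1 - s ^+ 2).
  move=> sI; have s01 : 0 < s < 1 by lra.
  have Q00 := quad_neq0 (Q0 s01).
  have Sp : 0 < S by lra.
  by rewrite /f1 /ws (exp_ws _ _ Sp (Q0 s01)) mulrAC divff.
have weq (s : R) : cos Rad < s < 1 ->
    n%:R * s * ws1 s - (1 - s ^+ 2) * ws2 s = L * f (ws s).
  move=> sI; have s01 : 0 < s < 1 by lra.
  have Q0s := Q0 s01; have Q00 := quad_neq0 Q0s.
  have := @log_identity _ N 0 s; rewrite !addr0 => /(_ Q0s) H.
  rewrite /ws1 /ws2 -/N H fE -/(f1 _) expws// [RHS]mulrBr LK LE.
  by field.
have wR : ws (cos Rad) = 0 by rewrite /ws -/S subrr.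
have wge (s : R) : cos Rad < s < 1 -> 0 <= ws s.
  move=> sI; have /andP[Qp QS'] : 0 < 1 - s ^+ 2 <= S by apply: QS; lra.
  by rewrite subr_ge0 ler_ln ?posrE//; lra.
have phd (s : R) : 0 < s < 1 -> is_derive s 1 (hardy A g) (hardy1 A g s).
  by move=> sI; exact: der_hardy (Q0 sI).
have ph1d (s : R) : 0 < s < 1 -> is_derive s 1 (hardy1 A g) (hardy2 A g s).
  by move=> sI; exact: der_hardy1 (Q0 sI).
have phpos (s : R) : cos Rad <= s < 1 -> 0 < hardy A g s.
  by move=> sI; apply: hardy_gt0; [lra|apply: Q0; lra].
have phge (s : R) : cos Rad < s < 1 -> L * f1 (ws s) * hardy A g s + f (ws s) <=
    n%:R * s * hardy1 A g s - (1 - s ^+ 2) * hardy2 A g s.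
  move=> sI; have s01 : 0 < s < 1 by lra.
  have Q0s := Q0 s01; have s1 : s < 1 by lra.
  have sR : cos Rad <= s by lra.
  (* In terms of [g] this is 8 g <= 4 g^2, that is g >= 2, exactly n >= 10. *)
  have lg : L <= 4 * g ^+ 2 by rewrite LE Ng; nra.
  have H := hardy_ge (erefl A) g1 s1 Q0s (sg s sR) lg.
  rewrite -/N Ng; apply: le_trans H; rewrite fE -/(f1 _) expws// mul1r lerD2l.
  have Q1 : 1 - s ^+ 2 <= 1 by have := sqr_ge0 s; lra.
  have : (1 - s ^+ 2) `^ (- 1) <= (1 - s ^+ 2) `^ (- g).
    by apply: ger_powR; rewrite ?Q0s ?lerN2.
  by rewrite powR_inv1 ?(ltW Q0s)//; lra.
have wsph (e : R) : 0 < e -> \forall s \near 1^'-, ws s <= e * hardy A g s.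
  (* The logarithm is controlled by ln y <= y at y = 1 / Q, so a power of exponent 1 < g dominates
     ws. *)
  move=> e0; have kg : 1 < g by rewrite /g; lra.
  have A1 : A < 1 by lra.
  apply: filterS2 (near1_hardy A1 kg e0) (near1_small ltr01) => s H /andP[Qp _].
  apply: le_trans H; rewrite /ws powR_inv1 ?(ltW Qp)//.
  have lnS : ln S <= 0 by apply: ln_le0; lra.
  have : ln (1 - s ^+ 2)^-1 <= (1 - s ^+ 2)^-1.
    have Qi : 0 < (1 - s ^+ 2)^-1 by rewrite invr_gt0.
    have := @le_ln1Dx _ ((1 - s ^+ 2)^-1 - 1).
    rewrite addrCA subrr addr0 => Hl; apply: le_trans (Hl _) _; lra.
  by rewrite lnV ?posrE//; lra.
have wsoo (B : R) : \forall s \near 1^'-, B < ws s.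
  have r0 : 0 < S * expR (- B) by rewrite mulr_gt0 ?expR_gt0//; lra.
  apply: filterS (near1_small r0) => s /andP[Qp Qr].
  have : ln (1 - s ^+ 2) < ln (S * expR (- B)) by rewrite ltr_ln ?posrE.
  by rewrite lnM ?posrE ?expR_gt0// ?expRK /ws; lra.
have sup (lam : R) : 0 < lam < L -> exists V V1 V2 : R -> R, exists2 b : R,
  1 < b & [/\ forall s : R, 0 < s < b -> is_derive s 1 V (V1 s),
    forall s : R, 0 < s < b -> is_derive s 1 V1 (V2 s) /\ {for s, continuous V2},
    forall s : R, cos Rad <= s <= 1 -> 0 <= V s,
    forall s : R, cos Rad < s <= 1 -> lam * f (V s) <= n%:R * s * V1 s - (1 - s ^+ 2) * V2 s
  & forall s : R, cos Rad < s < 1 -> V s <= ws s].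
  move=> {fd f1c f1m fm fconv wsd ws1d expws weq wR wge phd ph1d phpos phge wsph wsoo f0}.
  move=> {N10' N6 g1 Ng AR sg n10 RadE} lamL; have lam0 : 0 < lam by case/andP: lamL.
  have Z0 : 0 <= K * (L - lam) + lam / S + 2.
    have H1 : 0 <= K * (L - lam) by rewrite mulr_ge0//; lra.
    have H2 : 0 <= lam / S by rewrite divr_ge0//; lra.
    lra.
  have W0 : 0 < (L - lam) * (1 - S * K) by rewrite mulr_gt0//; lra.
  have [d d01 dZ] := small_delta Z0 W0.
  have d0 : 0 < d by lra.
  have Pb (s : R) : 0 < s < 1 + d / 4 -> 0 < 1 + d - s ^+ 2 by move=> sI; nra.
  have PS (s : R) : cos Rad <= s <= 1 -> 0 < 1 + d - s ^+ 2 <= S + d.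
    by move=> sI; rewrite /S; move: (cos Rad) cR' sI => x xI sI; nra.
  exists (fun s => ln (S + d) - ln (1 + d - s ^+ 2)), (fun s => 2 * s / (1 + d - s ^+ 2)),
    (fun s => 2 / (1 + d - s ^+ 2) + 4 * s ^+ 2 / (1 + d - s ^+ 2) ^+ 2), (1 + d / 4); first lra.
  split.
  - by move=> s sI; exact: der_log (Pb s sI).
  - by move=> s sI; split; [exact: der_log1 (Pb s sI)|exact: log2_continuous (Pb s sI)].
  - by move=> s sI; have := PS s sI; rewrite subr_ge0 => PI; rewrite ler_ln ?posrE; lra.
  - move=> s sI; have sI' : cos Rad <= s <= 1 by lra.
    have PI := PS s sI'; have P0 : 0 < 1 + d - s ^+ 2 by lra.
    have P00 := quad_neq0 P0.
    have Sp : 0 < S by lra.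
    have H := supersol_bound d0 PI Sp (ltW K0) lamL dZ.
    rewrite log_identity// fE exp_ws//; last lra.
    have -> : (S + d) / (1 + d - s ^+ 2) / S = (1 + d / S) / (1 + d - s ^+ 2).
      by field; rewrite S00 P00.
    apply: (le_trans H); rewrite LK LE -/N lerDl.
    by rewrite divr_ge0 ?sqr_ge0//; nra.
  - move=> s sI; have sI' : cos Rad <= s < 1 by lra.
    have /andP[Qp QS'] := QS sI'.
    have P0 : 0 < 1 + d - s ^+ 2 by lra.
    have : ln ((S + d) * (1 - s ^+ 2)) <= ln (S * (1 + d - s ^+ 2)).
      have S0' : 0 < S by lra.
      have Sd : 0 < S + d by lra.
      rewrite ler_ln ?posrE ?mulr_gt0//.
      have : d * (1 - s ^+ 2) <= d * S by rewrite ler_pM2l.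
      lra.
    have S0' : 0 < S by lra.
    have Sd : 0 < S + d by lra.
    by rewrite !lnM ?posrE// /ws; lra.
exact: (@extremal_profile R n c Rad L f f1 ws ws1 ws2 (hardy A g) (hardy1 A g) (hardy2 A g)
  n3 cs Rad0 Rad2 L0 fd f1c fm f0 fconv wsd ws1d weq wR wge phd ph1d phpos phge wsph wsoo sup).
Qed.


Lemma pow_extremal (m : R) : 1 < m -> Nm m <= n%:R ->
  Rad < asin (Num.sqrt ((n%:R - 2) / n%:R)) ->
  let f := f_pow n m Rad in let L := 2 / (m - 1) * (n%:R - 2 * m / (m - 1)) in
  lamstar c Rad f = L /\
  forall U : R -> 'rV[R]_n.+1 -> R,
    (forall lam, 0 < lam < L -> minimal_sol c Rad f lam (U lam)) ->
    (U lam c @[lam --> L^'-] --> +oo) /\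
    (forall p, gball c Rad p -> p != c ->
       U lam p @[lam --> L^'-] -->
         (1 - edot p c ^+ 2) `^ (- (m - 1)^-1) - sin Rad `^ (- (2 / (m - 1)))).
Proof.
move=> m1 nm RadE f L.
have [[k0 km N6 kg] [LE LK L0] /andP[K0 KN] lg] := pow_params m1 nm.
have [g1 Ng AR sg] := N10 N6.
have SK : S * (((m - 1) * N - (m + 1)) / ((m - 1) * N - 2 * m)) < 1.
  move: K0 KN; rewrite -/N; move: (_ / _) => K K0 KN.
  have N0 : 0 < N by rewrite (lt_le_trans _ N6).
  have N2 : 0 < N - 2 by rewrite subr_gt0 (lt_le_trans _ N6)// ltr_nat.
  have q01 : 0 <= (N - 2) / N <= 1.
    by rewrite divr_ge0 ?(ltW N2) ?(ltW N0)//= ler_pdivrMr// mul1r gerBl.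
  have SN := sin_lt_asin Rad0 Rad2 q01 RadE.
  have -> : 1 = (N - 2) / N * (N / (N - 2)).
    by rewrite mulf_div [N * _]mulrC divff// mulf_neq0// gt_eqF.
  apply: (@lt_le_trans _ _ ((N - 2) / N * K)); first by rewrite ltr_pM2r.
  by rewrite ler_wpM2l//; case/andP: q01.
have aE : sin Rad `^ (- (2 / (m - 1))) = S `^ (- (m - 1)^-1).
  have sR0 : 0 < sin Rad by apply: sin_gt0_pihalf; rewrite Rad0.
  by rewrite -mulrN powRrM -[2]/(2%:R) powR_mulrn ?(ltW sR0)// sin2S.
have lg' : L * m <= 4 * g ^+ 2.
  by apply: le_trans lg _; rewrite /g -/N le_eqVlt; apply/orP; left; apply/eqP; field.
have := pow_core n3 cs Rad0 Rad2 (erefl S) Ng g1 AR sg (erefl A) m1 k0 km kg K0 SK L0 LE LK lg'.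
rewrite -aE.
by [].
Qed.

End ExtremalSolution.

Lemma gball_sin {R : realType} {n : nat} (c p : 'rV[R]_n.+1) (Rad : R) :
  on_sphere c -> 0 < Rad -> Rad < pi / 2 -> gball c Rad p -> p != c ->
  0 < sin (gdist c p) /\ sin (gdist c p) ^+ 2 = 1 - edot p c ^+ 2.
Proof.
move=> cs Rad0 Rad2 /(gballP cs Rad0 Rad2)[ps pR] pc.
have /andP[x0 x1] := cos_Rad Rad0 Rad2.
have /andP[pm p1] := edot_sphere_le1 ps cs.
have p1' : edot p c < 1.
  rewrite lt_neqAle p1 andbT; apply: contra pc => /eqP.
  by move/(edot_sphere_eq1 ps cs) => ->.
have Q0 : 0 < 1 - edot p c ^+ 2 by nra.
rewrite /gdist sin_acos ?pm ?p1// sqr_sqrtr ?(ltW Q0)//; split=> //.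
by rewrite sqrtr_gt0.
Qed.

(** The extremal solution is rendered as the left limit at the extremal parameter of an arbitrary
    family of minimal solutions; minimality determines such a family on the ball. The centre is
    separated because both profiles are infinite there. *)
Theorem theorem1p6 (R : realType) (n : nat) (c : 'rV[R]_n.+1) (Rad : R) :
  (3 <= n)%N -> on_sphere c -> 0 < Rad -> Rad < pi / 2 ->
  (* (i) exponential nonlinearity *)
  ((10 <= n)%N -> Rad < R0 R n ->
   Rad < asin (Num.sqrt ((n%:R - 2) / (n%:R - 1))) ->
   let f := f_exp n Rad in
   lamstar c Rad f = 2 * (n%:R - 2) /\
   forall U : R -> 'rV[R]_n.+1 -> R,
     (forall lam, 0 < lam < lamstar c Rad f -> minimal_sol c Rad f lam (U lam)) ->
     (U lam c @[lam --> (lamstar c Rad f)^'-] --> +oo) /\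
     (forall p, gball c Rad p -> p != c ->
        U lam p @[lam --> (lamstar c Rad f)^'-] -->
          - 2 * ln (sin (gdist c p) / sin Rad)))
  /\
  (* (ii) power-type nonlinearity *)
  (forall m : R, 1 < m -> Nm m <= n%:R -> Rad < R0 R n ->
   Rad < asin (Num.sqrt ((n%:R - 2) / n%:R)) ->
   let f := f_pow n m Rad in
   lamstar c Rad f = 2 / (m - 1) * (n%:R - 2 * m / (m - 1)) /\
   forall U : R -> 'rV[R]_n.+1 -> R,
     (forall lam, 0 < lam < lamstar c Rad f -> minimal_sol c Rad f lam (U lam)) ->
     (U lam c @[lam --> (lamstar c Rad f)^'-] --> +oo) /\
     (forall p, gball c Rad p -> p != c ->
        U lam p @[lam --> (lamstar c Rad f)^'-] -->
          sin (gdist c p) `^ (- (2 / (m - 1))) - sin Rad `^ (- (2 / (m - 1))))).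
Proof.
move=> n3 cs Rad0 Rad2; split.
  move=> n10 RR0 RE f.
  have [lE H] := exp_extremal n3 cs Rad0 Rad2 RR0 n10 RE.
  rewrite lE; split=> // U /H[Hc Hp]; split=> // p pB pc.
  have [s0 sE] := gball_sin cs Rad0 Rad2 pB pc.
  have sR0 : 0 < sin Rad by apply: sin_gt0_pihalf; rewrite Rad0.
  have -> : - 2 * ln (sin (gdist c p) / sin Rad) =
      ln (1 - cos Rad ^+ 2) - ln (1 - edot p c ^+ 2).
    rewrite -(sin2cos2 Rad) -sE (lnXn 2 sR0) (lnXn 2 s0) ln_div ?posrE//.
    by rewrite !mulr2n; ring.
  exact: Hp.
move=> m m1 nm RR0 RE f.
have [lE H] := pow_extremal n3 cs Rad0 Rad2 RR0 m1 nm RE.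
rewrite lE; split=> // U /H[Hc Hp]; split=> // p pB pc.
have [s0 sE] := gball_sin cs Rad0 Rad2 pB pc.
have -> : sin (gdist c p) `^ (- (2 / (m - 1))) = (1 - edot p c ^+ 2) `^ (- (m - 1)^-1).
  by rewrite -sE -mulrN powRrM -[2]/(2%:R) powR_mulrn// ltW.
exact: Hp.
Qed.
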